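(* Let $M$ be a $3$-connected regular matroid having at least four elements, and let $\{a,b,c\}$ be a triangle of $M$. Then there is a flat $F$ of $M$ such that (i) $M|F$ is the cycle matroid of an enlarged wheel $W$, and (ii) in $W$, the edge $a$ is a rim edge, the edges $b$ and $c$ are spokes, and $a$, $b$, and $c$ form a triangle.
   Context: All matroids are finite. A triangle of a matroid is a three-element circuit. For $n\geq 2$, a wheel is a graph obtained from an $n$-cycle (the rim) by adding a vertex $v$ and joining $v$ to every vertex of the rim by a single edge (a spoke). An enlarged wheel is a graph obtained from a wheel by adding parallel edges to spoke edges (these are also called spokes), and subdividing rim edges. The rim of an enlarged wheel is the (potentially subdivided) rim of the initial wheel. *)

(* Defs.v *)
From HB Require Import structures.
From mathcomp Require Import all_boot all_order all_algebra.

Set Implicit Arguments.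
Unset Strict Implicit.
Unset Printing Implicit Defensive.

Import GRing.Theory.

(** * Matroids

    The ground set is a subset of an ambient finite type, so that a matroid and
    its restrictions have elements of the same type. *)

Record matroid (E : finType) := Matroid {
  ground : {set E};
  indep : pred {set E};
  indep_ground : forall I : {set E}, indep I -> I \subset ground;
  indep0 : indep set0;
  indepS : forall I J : {set E}, J \subset I -> indep I -> indep J;
  indep_aug : forall I J : {set E}, indep I -> indep J -> #|I| < #|J| ->
    exists2 x, x \in J :\: I & indep (x |: I) }.

Section MatroidTheory.

Variables (E : finType) (M : matroid E).

Definition rank (X : {set E}) : nat := \max_(I in powerset X | indep M I) #|I|.

Definition closure (X : {set E}) : {set E} :=
  [set x in ground M | rank (x |: X) == rank X].

Definition flat (F : {set E}) : Prop := closure F = F.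

Definition circuit (C : {set E}) : bool :=
  minset [pred X : {set E} | (X \subset ground M) && ~~ indep M X] C.

Definition triangle (T : {set E}) : Prop := circuit T /\ #|T| = 3.

(* The inequality is r(X) + r(E - X) - r(M) < k, free of truncated
   subtraction. *)
Definition separation (k : nat) (X : {set E}) : Prop :=
  [/\ X \subset ground M, k <= #|X|, k <= #|ground M :\: X|
    & rank X + rank (ground M :\: X) < rank (ground M) + k].

Definition connected (n : nat) : Prop :=
  forall k X, 0 < k < n -> ~ separation k X.

Lemma restrict_ground (F I : {set E}) :
  indep M I && (I \subset F) -> I \subset ground M :&: F.
Proof. by case/andP=> /indep_ground IE IF; rewrite subsetI IE. Qed.

Lemma restrict0 (F : {set E}) : indep M set0 && (set0 \subset F).
Proof. by rewrite indep0 sub0set. Qed.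

Lemma restrictS (F I J : {set E}) : J \subset I ->
  indep M I && (I \subset F) -> indep M J && (J \subset F).
Proof.
by move=> JI /andP[iI IF]; rewrite (indepS JI iI) (subset_trans JI IF).
Qed.

Lemma restrict_aug (F I J : {set E}) :
  indep M I && (I \subset F) -> indep M J && (J \subset F) -> #|I| < #|J| ->
  exists2 x, x \in J :\: I & indep M (x |: I) && (x |: I \subset F).
Proof.
move=> /andP[iI IF] /andP[iJ JF] ltIJ.
have [x xJI ixI] := indep_aug iI iJ ltIJ; exists x => //.
rewrite ixI subUset IF sub1set andbT (subsetP JF) //.
by case/setDP: xJI.
Qed.

Definition restrict (F : {set E}) : matroid E :=
  Matroid (@restrict_ground F) (restrict0 F) (@restrictS F) (@restrict_aug F).

End MatroidTheory.

(** * Regular matroids *)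

Definition totally_unimodular (m n : nat) (A : 'M[rat]_(m, n)) : Prop :=
  forall (k : nat) (f : 'I_k -> 'I_m) (g : 'I_k -> 'I_n),
  injective f -> injective g -> (\det (mxsub f g A) \in [:: 0; 1; -1])%R.

(* Column j of the matrix is labelled by [enum_val j], the j-th element of the
   ground set. *)
Definition represents (E : finType) (M : matroid E) (m : nat)
    (A : 'M[rat]_(m, #|ground M|)) : Prop :=
  forall I : {set E}, I \subset ground M ->
  indep M I = free [seq col j A | j <- enum 'I_#|ground M| & enum_val j \in I].

Definition regular (E : finType) (M : matroid E) : Prop :=
  exists (m : nat) (A : 'M[rat]_(m, #|ground M|)),
    totally_unimodular A /\ represents A.

(** * Multigraphs

    An edge with two ends has [ends e = [set u; w]]; a loop at u has
    [ends e = [set u]]. The value of [ends] outside [edges] is irrelevant. *)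

Record mgraph (V E : finType) := MGraph {
  verts : {set V};
  edges : {set E};
  ends : E -> {set V};
  ends_verts : forall e, e \in edges -> ends e \subset verts;
  card_ends : forall e, e \in edges -> 0 < #|ends e| <= 2 }.

Section GraphTheory.

Variables (V E : finType).
Implicit Types (G H : mgraph V E) (C R S : {set E}).

(* Indices are cyclic ([ordS] is the successor modulo n). The case n = 1 is a
   loop, and n = 2 is a pair of distinct parallel edges. *)
Definition ncycle G (n : nat) (v : 'I_n -> V) (e : 'I_n -> E) : Prop :=
  [/\ injective v, injective e, forall i, e i \in edges G
    & forall i, ends G (e i) = [set v i; v (ordS i)]].

Definition graph_cycle G C : Prop :=
  exists n (v : 'I_n -> V) (e : 'I_n -> E),
    [/\ 0 < n, ncycle G v e & C = [set e i | i : 'I_n]].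

Definition graph_triangle G C : Prop := graph_cycle G C /\ #|C| = 3.

Definition is_cycle_matroid (M : matroid E) G : Prop :=
  ground M = edges G /\ forall C, circuit M C <-> graph_cycle G C.

(* G is a wheel with set of rim edges R and set of spokes S. *)
Definition wheel G R S : Prop :=
  exists n (hub : V) (v : 'I_n -> V) (r s : 'I_n -> E),
    [/\ 2 <= n, ncycle G v r & forall i, hub != v i] /\
    [/\ forall i, ends G (s i) = [set hub; v i],
        verts G = hub |: [set v i | i : 'I_n],
        edges G = R :|: S,
        R = [set r i | i : 'I_n] & S = [set s i | i : 'I_n]].

(* H is obtained from G by adding a new edge e parallel to f. *)
Definition add_parallel G (f e : E) H : Prop :=
  [/\ f \in edges G, e \notin edges G & verts H = verts G] /\
  [/\ edges H = e |: edges G, ends H e = ends G f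
    & {in edges G, ends H =1 ends G}].

(* H is obtained from G by subdividing the edge f = uw with a new vertex x; of
   the two resulting edges, ux keeps the name f and xw is the new edge e. *)
Definition subdivide G (f e : E) (x : V) H : Prop :=
  [/\ f \in edges G, e \notin edges G & x \notin verts G] /\
  [/\ verts H = x |: verts G, edges H = e |: edges G,
      exists u w, [/\ ends G f = [set u; w], ends H f = [set u; x]
                    & ends H e = [set x; w]]
    & {in edges G :\ f, ends H =1 ends G}].

Inductive enlarged_wheel : mgraph V E -> {set E} -> {set E} -> Prop :=
| Enlarged_wheel_base G R S :
    wheel G R S -> enlarged_wheel G R S
| Enlarged_wheel_parallel G R S f e H :
    enlarged_wheel G R S -> f \in S -> add_parallel G f e H ->
    enlarged_wheel H R (e |: S)
| Enlarged_wheel_subdivide G R S f e x H :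
    enlarged_wheel G R S -> f \in R -> subdivide G f e x H ->
    enlarged_wheel H (e |: R) S.

End GraphTheory.

(* Main.v *)
From HB Require Import structures.
From mathcomp Require Import all_boot all_order all_algebra zify ring lra.
Require Import Defs.

Set Implicit Arguments.
Unset Strict Implicit.
Unset Printing Implicit Defensive.

Import GRing.Theory.

(** In a 3-connected graph, let b and c meet at the vertex v. A shortest cycle C
    through a that avoids v is induced, and together with v it induces an
    enlarged wheel with hub v. The proof carries this over to matroids.

    A regular matroid has vector representations over the rationals and over
    the two-element field ([regular_vector_reps]). Over the latter, the sets with
    zero sum are the cycles, closed under symmetric difference, and the circuits
    are the minimal nonempty cycles ([circuit_min_cycle]).

    The cycle C avoiding v becomes a circuit through a whose span misses b. If
    there were none, every circuit of M/b\c through a would be completed to a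
    circuit of M by b. As M/b\c is connected, its circuits through a generate
    all of its cycles, so every cycle of M would contain both or neither of a and
    b; but M has no such pair. Taken of least size, C is a flat, since an element
    in its span would split it into two smaller circuits, one of them through a
    ([flat_circuit_exists]).

    Let F be the closure of C and b. Every element e of F outside C is, over the
    two-element field, the sum of b and of an arc of C, a subset of C - a. The
    arc of b is empty and that of c is C - a. If C is the rim of a wheel and
    the other elements are its spokes, then the arcs are the initial segments of
    the path C - a. In general they at least form a chain ([arcs_chain]): two
    incomparable arcs produce a Fano minor, which the rational representation
    forbids. Ordering C - a along this chain makes every arc an initial segment
    ([chain_ordering]), and the graph in which the spoke e joins a hub to the
    end of its arc has the same cycles on F as M ([cycle_space_agree]). Its
    minimal nonempty even sets are its graph cycles ([min_even_graph_cycle]), and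
    it is an enlarged wheel because each rim vertex without a spoke comes from a
    subdivision ([spoked_cycle_enlarged]). No two spokes are parallel, M being
    simple. *)

(** * Rational and binary vector representations *)

Section ColumnIndependence.

Local Open Scope ring_scope.

Variables (F : fieldType) (m n : nat).
Implicit Types (A : 'M[F]_(m, n)) (P : {set 'I_n}).

Lemma free_colsub A P :
  free [seq col j A | j <- enum 'I_n & j \in P]
  = row_full (colsub (enum_val : 'I_#|P| -> 'I_n) A).
Proof.
have -> : [seq j <- enum 'I_n | j \in P] = enum P by rewrite enumT.
have -> : [seq col j A | j <- enum P]
    = [tuple col (enum_val i) A | i < #|P|] :> seq _.
  apply: (@eq_from_nth _ 0) => [|i]; first by rewrite size_map -cardE size_tuple.
  rewrite size_map -cardE => ltiP.
  pose i0 : 'I_#|P| := Ordinal ltiP.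
  rewrite -[i in RHS]/(val i0) -[RHS]tnth_nth tnth_mktuple.
  rewrite (nth_map (enum_val i0)) -?cardE //; congr col.
  by rewrite [RHS](enum_val_nth (enum_val i0)).
set X := mktuple _.
have eqX (k : 'I_#|P| -> F) : \sum_i k i *: X`_i =
    colsub (enum_val : 'I_#|P| -> 'I_n) A *m \col_i k i.
  apply/colP => a; rewrite summxE mxE; apply: eq_bigr => i _.
  by rewrite -tnth_nth tnth_mktuple !mxE mulrC.
apply/freeP/idP => [freeX | full k].
  rewrite -(trmxK (colsub _ _)) /row_full mxrank_tr -/(row_free _) -kermx_eq0.
  apply/rowV0P => v /sub_kermxP /(congr1 trmx).
  rewrite trmx_mul trmxK trmx0 => v0; apply/rowP => i; rewrite mxE.
  apply: (freeX (fun j => v 0 j)); rewrite eqX -[RHS]v0; congr (_ *m _).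
  by apply/colP => j; rewrite !mxE.
rewrite eqX -(mulmx0 1 (colsub (enum_val : 'I_#|P| -> 'I_n) A)).
by move=> /(row_full_inj full) /colP k0 i; move: (k0 i); rewrite !mxE.
Qed.

Lemma row_full_minorP k (B : 'M[F]_(m, k)) :
  reflect (exists2 f : 'I_k -> 'I_m, injective f & \det (rowsub f B) != 0)
          (row_full B).
Proof.
apply: (iffP idP) => [fullB | [f _ detf]].
  exists (fullrankfun fullB); first exact: fullrankfun_inj.
  by have := fullrowsub_unit fullB; rewrite unitmxE unitfE.
have : row_full (rowsub f B) by rewrite row_full_unit unitmxE unitfE.
case/row_fullP => D D1; apply/row_fullP.
by exists (D *m rowsub f 1%:M); rewrite -mulmxA -rowsubE.
Qed.

End ColumnIndependence.

Section TotallyUnimodular.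

Local Open Scope ring_scope.

(** Independence of columns is decided by minors, and a minor with value 0, 1 or
    -1 vanishes over the rationals exactly when it vanishes modulo 2. *)
Lemma totally_unimodular_mod2 m n (A : 'M[rat]_(m, n)) :
  totally_unimodular A ->
  exists A2 : 'M['F_2]_(m, n), forall P : {set 'I_n},
    free [seq col j A | j <- enum 'I_n & j \in P]
    = free [seq col j A2 | j <- enum 'I_n & j \in P].
Proof.
move=> TU.
have entry i j : A i j \in [:: 0; 1; -1].
  have inj (T : Type) (x : T) : injective (fun _ : 'I_1 => x).
    by move=> u v _; rewrite (ord1 u) (ord1 v).
  have := TU 1 (fun=> i) (fun=> j) (inj _ i) (inj _ j).
  by rewrite det_mx11 mxE.
pose Az : 'M[int]_(m, n) := \matrix_(i, j) numq (A i j).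
have AE : A = map_mx (intr : int -> rat) Az.
  apply/matrixP => i j; rewrite !mxE.
  by move: (entry i j); rewrite !inE => /or3P[] /eqP ->.
exists (map_mx (intr : int -> 'F_2) Az) => P; rewrite !free_colsub.
set g := enum_val.
have detE (K : fieldType) (f : 'I_#|P| -> 'I_m) :
    \det (rowsub f (colsub g (map_mx (intr : int -> K) Az)))
    = (\det (mxsub f g Az))%:~R.
  by rewrite -det_map_mx; congr (\det _); apply/matrixP => i j; rewrite !mxE.
apply/row_full_minorP/row_full_minorP => -[f injf detf]; exists f => //.
  have := TU _ f g injf (@enum_val_inj _ _); move: detf.
  rewrite {1}AE detE detE.
  have -> : \det (mxsub f g A) = (\det (mxsub f g Az))%:~R.
    by rewrite -det_map_mx AE; congr (\det _); apply/matrixP => i j; rewrite !mxE.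
  rewrite intr_eq0 !inE => d0.
  rewrite intr_eq0 (negPf d0) /= -[1]/(1%:~R) -[- 1%:~R]/((-1)%:~R) !eqr_int.
  by case/orP => /eqP ->.
rewrite AE detE; rewrite detE in detf.
by apply: contraNneq detf => /eqP; rewrite intr_eq0 => /eqP ->.
Qed.

End TotallyUnimodular.

Section VectorRepresentation.

Local Open Scope ring_scope.

(** The dependent case asks for an explicit relation rather than for the failure
    of the first case, so that relations can be chosen constructively. *)
Definition vector_rep (E : finType) (M : matroid E) (F : fieldType)
    (U : lmodType F) (psi : E -> U) : Prop :=
  forall I : {set E}, I \subset ground M ->
  (indep M I -> forall w : E -> F, (forall x, x \notin I -> w x = 0) ->
     \sum_x w x *: psi x = 0 -> forall x, w x = 0) /\
  (~~ indep M I -> exists w : E -> F, [/\ forall x, x \notin I -> w x = 0,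
     \sum_x w x *: psi x = 0 & exists x, w x != 0]).

Lemma vector_rep_columns (E : finType) (M : matroid E) (F : fieldType) m
    (A : 'M[F]_(m, #|ground M|)) :
  (forall I : {set E}, I \subset ground M ->
     indep M I =
     free [seq col j A | j <- enum 'I_#|ground M| & enum_val j \in I]) ->
  exists psi : E -> 'cV[F]_m, vector_rep M psi.
Proof.
move=> repA.
(* An element outside the ground set labels no column and gets the empty sum. *)
exists (fun x => \sum_(j | enum_val j == x) col j A) => I IM.
have sumE (w : E -> F) : (forall x, x \notin I -> w x = 0) ->
    \sum_x w x *: (\sum_(j | enum_val j == x) col j A)
    = \sum_j w (enum_val j) *: col j A.
  move=> w0; transitivity (\sum_x \sum_(j | enum_val j == x)
      w (enum_val j) *: col j A).
    by apply: eq_bigr => x _; rewrite scaler_sumr; apply: eq_bigr => j /eqP ->.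
  by rewrite [RHS](partition_big (fun j => enum_val j) xpredT).
pose P := [set j : 'I_#|ground M| | enum_val j \in I].
rewrite repA //.
have -> : [seq col j A | j <- enum 'I_#|ground M| & enum_val j \in I]
    = [seq col j A | j <- enum 'I_#|ground M| & j \in P].
  by congr map; apply: eq_filter => j; rewrite inE.
have mulE (v : 'cV[F]_#|ground M|) : A *m v = \sum_j v j 0 *: col j A.
  apply/colP => a; rewrite summxE mxE; apply: eq_bigr => j _.
  by rewrite !mxE mulrC.
rewrite free_colsub; split => [full w w0 sumw x | ].
  case: (boolP (x \in I)) => [xI|/w0 //].
  have xM := subsetP IM x xI.
  pose v : 'cV[F]_#|P| := \col_i w (enum_val (enum_val i)).
  suff v0 : v = 0.
    have jP : enum_rank_in xM x \in P by rewrite inE enum_rankK_in.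
    have /colP/(_ (enum_rank_in jP (enum_rank_in xM x))) := v0.
    by rewrite !mxE enum_rankK_in // enum_rankK_in.
  apply: (row_full_inj full); rewrite mulmx0 -[RHS]sumw sumE //.
  apply/colP => a; rewrite mxE summxE [RHS](bigID (mem P)) /=.
  rewrite [X in _ + X]big1 => [|j]; last first.
    by rewrite inE => /w0 ->; rewrite scale0r mxE.
  rewrite addr0 [RHS]big_enum_val /=; apply: eq_bigr => i _.
  by rewrite !mxE mulrC.
rewrite -(trmxK (colsub _ _)) /row_full mxrank_tr -/(row_free _) -kermx_eq0.
case/rowV0Pn => v /sub_kermxP /(congr1 trmx) + /eqP vn0.
rewrite trmx_mul trmxK trmx0 => v0.
pose w x := \sum_(k < #|P| | enum_val (enum_val k) == x) v 0 k.
have wE k : w (enum_val (enum_val k)) = v 0 k.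
  rewrite /w (bigD1 k) //= big1 ?addr0 // => l /andP[/eqP eq nk].
  by case/eqP: nk; apply/enum_val_inj/enum_val_inj.
have w0 x : x \notin I -> w x = 0.
  move=> xI; rewrite /w big1 // => k /eqP kx; case/negP: xI; rewrite -kx.
  by have := enum_valP k; rewrite inE.
exists w; split=> //; last first.
  have [i vi|none] := pickP (fun i => v 0 i != 0).
    by exists (enum_val (enum_val i)); rewrite wE.
  by case: vn0; apply/rowP => i; rewrite mxE; apply/eqP/negbFE/none.
rewrite sumE // -[RHS]v0 (bigID (mem P)) /= [X in _ + X]big1 => [|j]; last first.
  by rewrite inE => /w0 ->; rewrite scale0r.
rewrite addr0 [LHS]big_enum_val /=; apply/colP => a; rewrite mxE summxE.
by apply: eq_bigr => k _; rewrite wE !mxE mulrC.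
Qed.

Lemma regular_vector_reps (E : finType) (M : matroid E) : regular M ->
  exists m (psi : E -> 'cV[rat]_m) (phi : E -> 'cV['F_2]_m),
    vector_rep M psi /\ vector_rep M phi.
Proof.
move=> [m [A [TU repA]]].
have [A2 eqA2] := totally_unimodular_mod2 TU.
have [psi repQ] := vector_rep_columns repA.
have [|phi rep2] := @vector_rep_columns E M 'F_2 m A2; last first.
  by exists m, psi, phi.
move=> I IM; rewrite repA //.
have eqP : (fun j => enum_val j \in I)
    =1 [in [set j : 'I_#|ground M| | enum_val j \in I]].
  by move=> j; rewrite !inE.
by rewrite !(eq_filter eqP).
Qed.

End VectorRepresentation.

(** * Cycle spaces *)

Section CycleSpaces.

Variable T : finType.
Implicit Types (A B C D : {set T}) (x : T).

Definition symdiff A B := (A :\: B) :|: (B :\: A).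

Lemma in_symdiff A B x : (x \in symdiff A B) = (x \in A) (+) (x \in B).
Proof. by rewrite !inE; case: (x \in A); case: (x \in B). Qed.

Lemma symdiffK A B : symdiff (symdiff A B) B = A.
Proof. by apply/setP => x; rewrite !in_symdiff addbK. Qed.

Lemma symdiffC A B : symdiff A B = symdiff B A.
Proof. by rewrite /symdiff setUC. Qed.

Lemma symdiffxx A : symdiff A A = set0.
Proof. by apply/setP => x; rewrite in_symdiff addbb inE. Qed.

Lemma symdiff0 A : symdiff A set0 = A.
Proof. by apply/setP => x; rewrite in_symdiff inE addbF. Qed.

Lemma symdiff_eq0 A B : symdiff A B = set0 -> A = B.
Proof. by move=> d; rewrite -(symdiffK A B) d symdiffC symdiff0. Qed.

Definition cycle_space (Z : pred {set T}) : Prop :=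
  Z set0 /\ forall A B, Z A -> Z B -> Z (symdiff A B).

Definition min_cycle (Z : pred {set T}) C : bool :=
  minset [pred X : {set T} | Z X && (X != set0)] C.

Lemma min_cycleP (Z : pred {set T}) C :
  reflect [/\ Z C, C != set0 &
            forall D, Z D -> D != set0 -> D \subset C -> D = C]
          (min_cycle Z C).
Proof.
apply: (iffP minsetP) => [[/andP[ZC nC] minC] | [ZC nC minC]].
  by split=> // D ZD nD; apply: minC; rewrite /= ZD.
by split=> [|D /andP[ZD nD]]; [apply/andP | apply: minC].
Qed.

Section Theory.

Variables (Z : pred {set T}) (spaceZ : cycle_space Z).

Lemma cycle_space_symdiffr A B : Z B -> Z (symdiff A B) = Z A.
Proof.
move=> ZB; have [_ ZD] := spaceZ.
by apply/idP/idP => [|/ZD]; [rewrite -{2}(symdiffK A B) => /ZD|]; apply.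
Qed.

(** Take a least cycle C containing x inside D. If a smaller nonempty cycle X
    lay in C, either X or the symmetric difference of C and X would contain x. *)
Lemma min_cycle_through D x : Z D -> x \in D ->
  exists C, [/\ min_cycle Z C, x \in C & C \subset D].
Proof.
move=> ZD xD; pose P := [pred X : {set T} | [&& Z X, x \in X & X \subset D]].
have PD : P D by rewrite /= ZD xD subxx.
have [C /minsetP[/and3P[ZC xC CD] minC] _] := minset_exists PD.
exists C; split=> //; apply/min_cycleP; split=> // [|X ZX nX XC].
  by apply/set0Pn; exists x.
have [xX|xX] := boolP (x \in X).
  by apply: minC => //=; rewrite ZX xX (subset_trans XC CD).
have : symdiff C X = C.
  apply: minC; last by apply/subsetP => y; rewrite in_symdiff;
    case: (boolP (y \in X)) => [/(subsetP XC) -> //|]; rewrite addbF.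
  rewrite /= cycle_space_symdiffr // ZC in_symdiff xC (negPf xX) /=.
  apply/subsetP => y; rewrite in_symdiff.
  case: (boolP (y \in X)) => [/(subsetP XC) -> //|_].
  by rewrite addbF => /(subsetP CD).
move=> eqC; have [y yX] := set0Pn _ nX.
by have := in_symdiff C X y; rewrite eqC yX (subsetP XC).
Qed.

End Theory.

Local Open Scope ring_scope.

Definition zero_sum (U : zmodType) (phi : T -> U) (D : {set T}) : bool :=
  \sum_(x in D) phi x == 0.

Lemma sum_symdiff (U : zmodType) (phi : T -> U) A B :
  (forall u : U, u + u = 0) ->
  \sum_(x in symdiff A B) phi x = \sum_(x in A) phi x + \sum_(x in B) phi x.
Proof.
move=> char2; rewrite big_mkcond [X in _ = X + _]big_mkcond /=.
rewrite [X in _ = _ + X]big_mkcond -big_split /=; apply: eq_bigr => x _.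
rewrite in_symdiff.
by case: (x \in A); case: (x \in B); rewrite ?char2 ?addr0 ?add0r.
Qed.

Lemma zero_sum_cycle_space (U : zmodType) (phi : T -> U) :
  (forall u : U, u + u = 0) -> cycle_space (zero_sum phi).
Proof.
move=> char2; split=> [|A B /eqP A0 /eqP B0]; rewrite /zero_sum ?big_set0 //.
by rewrite sum_symdiff // A0 B0 addr0.
Qed.

End CycleSpaces.

(** * Binary matroids as cycle spaces *)

(** Circuits of a binary matroid are recovered from its cycles, the supports of
    the relations over the two-element field; the vectors themselves are
    forgotten. *)
Definition binary_rep (E : finType) (M : matroid E) (Z : pred {set E}) : Prop :=
  [/\ forall D : {set E}, Z D -> D \subset ground M, cycle_space Z
    & forall I : {set E}, I \subset ground M ->
      indep M I <-> forall D : {set E}, Z D -> D \subset I -> D = set0].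

Lemma addff_F2 (m n : nat) (A : 'M['F_2]_(m, n)) : (A + A = 0)%R.
Proof.
apply/matrixP => i j; rewrite !mxE.
by case: (A i j) => [[|[|k]] lt]; apply/val_inj.
Qed.

Lemma F2_cases (t : 'F_2) : t = 0%R \/ t = 1%R.
Proof. by case: t => [[|[|k]] lt]; [left|right|]; try exact/val_inj. Qed.

(** Over the two-element field a relation is determined by its support. *)
Lemma vector_rep_binary (E : finType) (M : matroid E) m
    (phi : E -> 'cV['F_2]_m) : vector_rep M phi ->
  binary_rep M [pred D : {set E} | (D \subset ground M) && zero_sum phi D].
Proof.
move=> rep; have [Z0 ZD] := zero_sum_cycle_space phi (@addff_F2 m 1).
split=> [D /andP[] // | | I IM].
  split=> [|A B /andP[AM ZA] /andP[BM ZB]]; rewrite /= ?sub0set //.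
  rewrite ZD // andbT; apply/subsetP => x; rewrite !inE => /orP[] /andP[_ xin].
    exact: (subsetP AM).
  exact: (subsetP BM).
have [free_I dep_I] := rep I IM.
split=> [/free_I{dep_I}free_I D /andP[DM /eqP sumD] DI | min_I].
  apply/setP => x; rewrite inE; apply/negbTE/negP => xD.
  have := free_I (fun y => (y \in D)%:R%R) => /(_ _ _ x).
  rewrite xD => one0; have/eqP: (1 = 0 :> 'F_2)%R.
    apply: one0 => [y yI|]; first by case: (boolP (y \in D)) => // /(subsetP DI) /(negP yI).
    rewrite -[RHS]sumD [RHS]big_mkcond; apply: eq_bigr => y _.
    by case: (y \in D); rewrite ?scale1r ?scale0r.
  by rewrite oner_eq0.
apply: contraT => /dep_I[w [w0 sumw [x wx]]].
pose D := [set y | w y != 0%R].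
have DI : D \subset I.
  by apply/subsetP => y; rewrite inE; apply: contraR => /w0 ->.
have D0 : D = set0.
  apply: min_I => //; rewrite /= (subset_trans DI IM) /zero_sum.
  rewrite -[X in _ == X]sumw big_mkcond /=; apply/eqP/eq_bigr => y _.
  rewrite inE; case: (F2_cases (w y)) => -> //.
    by rewrite scale0r.
  by rewrite scale1r.
by have := in_set0 x; rewrite -D0 inE wx.
Qed.

Lemma circuit_min_cycle (E : finType) (M : matroid E) (Z : pred {set E}) C :
  binary_rep M Z -> circuit M C = min_cycle Z C.
Proof.
move=> [ZM spaceZ repZ]; apply/minsetP/min_cycleP.
  move=> [/andP[CM dep] minC].
  have [D ZD /andP[nD DC]] : exists2 D, Z D & (D != set0) && (D \subset C).
    case: (pickP [pred D : {set E} | [&& Z D, D != set0 & D \subset C]]).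
      by move=> D /and3P[ZD nD DC]; exists D; rewrite ?nD.
    move=> noD; case/negP: dep; apply/repZ => // D ZD DC; apply/eqP/negPn/negP.
    by move=> nD; have := noD D; rewrite /= ZD nD DC.
  have depD X : Z X -> X != set0 -> ~~ indep M X.
    move=> ZX nX; apply/negP => /(repZ _ (ZM _ ZX))/(_ X ZX (subxx X))/eqP.
    exact/negP.
  have eqDC : D = C by apply: minC; rewrite //= (ZM _ ZD) depD.
  rewrite -eqDC; split=> // X ZX nX XD.
  by rewrite eqDC; apply: minC; rewrite -?eqDC //= (ZM _ ZX) depD.
move=> [ZC nC minC]; split=> [|X /andP[XM dep] XC].
  rewrite /= (ZM _ ZC); apply/negP => /(repZ _ (ZM _ ZC)).
  by move=> /(_ C ZC (subxx C))/eqP; apply/negP.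
apply/eqP; rewrite eqEsubset XC /=; apply: contraR dep => nCX.
apply/(repZ _ XM) => D ZD DX; apply/eqP; apply: contraR nCX => nD.
by rewrite -(minC D ZD nD (subset_trans DX XC)).
Qed.

(** * Rank and closure *)

Section RankClosure.

Variables (E : finType) (M : matroid E).
Implicit Types (I J X Y : {set E}).

Lemma indep_rank I X : indep M I -> I \subset X -> #|I| <= rank M X.
Proof.
move=> iI IX; rewrite /rank.
by apply: (@leq_bigmax_cond _ _ (fun J : {set E} => #|J|)); rewrite inE IX.
Qed.

Lemma rank_le X k :
  (forall I, indep M I -> I \subset X -> #|I| <= k) -> rank M X <= k.
Proof.
by move=> le; apply/bigmax_leqP => I /andP[]; rewrite inE => IX iI; apply: le.
Qed.

Lemma rankS X Y : X \subset Y -> rank M X <= rank M Y.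
Proof.
move=> XY; apply: rank_le => I iI IX.
exact: indep_rank iI (subset_trans IX XY).
Qed.

Lemma rank_le_card X : rank M X <= #|X|.
Proof. by apply: rank_le => I _; apply: subset_leq_card. Qed.

Lemma rank_basis I X : indep M I -> I \subset X ->
  exists J, [/\ indep M J, I \subset J, J \subset X & #|J| = rank M X].
Proof.
move=> iI IX.
have [J0 /andP[J0X iJ0] rkJ0] : exists2 J0 : {set E},
    (J0 \in powerset X) && indep M J0 & rank M X = #|J0|.
  have [|J0 PJ0 eqJ0] := @eq_bigmax_cond _
      [pred J : {set E} | (J \in powerset X) && indep M J] (fun J => #|J|).
    by apply/card_gt0P; exists set0; rewrite !inE sub0set indep0.
  by exists J0.
rewrite inE in J0X.
have [k] := ubnP (rank M X - #|I|); elim: k I iI IX => // k IHk I iI IX lt.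
have [ltI|geI] := ltnP #|I| (rank M X); last first.
  by exists I; split=> //; apply/eqP; rewrite eqn_leq geI indep_rank.
rewrite rkJ0 in ltI.
have [x /setDP[xJ0 xI] ixI] := indep_aug iI iJ0 ltI.
have [|||J [iJ IJ JX rkJ]] := IHk (x |: I) => //.
- by rewrite subUset sub1set (subsetP J0X).
- by rewrite cardsU1 xI; move: lt; rewrite rkJ0; lia.
by exists J; split=> //; apply: subset_trans IJ; apply: subsetUr.
Qed.

(** An independent set in the closure larger than a basis I of X would enlarge
    I by an element x that does not raise the rank of X. *)
Lemma rank_closure X : X \subset ground M -> rank M (closure M X) = rank M X.
Proof.
move=> XM; apply/eqP; rewrite eqn_leq; apply/andP; split; last first.
  apply/rankS/subsetP => x xX; rewrite inE (subsetP XM) //=.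
  by rewrite (setUidPr _) ?sub1set.
have [I [iI _ IX rkI]] := rank_basis (indep0 M) (sub0set X).
apply: rank_le => J iJ JX; rewrite leqNgt -rkI; apply/negP => ltIJ.
have [x /setDP[xJ xI] ixI] := indep_aug iI iJ ltIJ.
have := subsetP JX x xJ; rewrite inE => /andP[_ /eqP rkx].
have : #|x |: I| <= rank M (x |: X) by rewrite indep_rank ?setUS.
by rewrite rkx -rkI cardsU1 xI ltnn.
Qed.

Lemma closure_flat X : X \subset ground M -> flat M (closure M X).
Proof.
move=> XM.
have sub Y : Y \subset ground M -> Y \subset closure M Y.
  move=> YM; apply/subsetP => x xY; rewrite inE (subsetP YM) //=.
  by rewrite (setUidPr _) ?sub1set.
have clM : closure M X \subset ground M by apply/subsetP => x; rewrite inE => /andP[].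
apply/eqP; rewrite eqEsubset; apply/andP; split; last exact: sub.
apply/subsetP => x; rewrite [x \in closure M (closure _ _)]inE => /andP[xM /eqP rkx].
rewrite inE xM eqn_leq (rankS (subsetUr [set x] X)) andbT /=.
rewrite -[leqRHS]rank_closure // -rkx; exact/rankS/setUS/sub.
Qed.

Variables (Z : pred {set E}) (repZ : binary_rep M Z).

Lemma indep_cycleP I : I \subset ground M ->
  reflect (forall D, Z D -> D \subset I -> D = set0) (indep M I).
Proof. by have [_ _ rep] := repZ; move=> IM; apply: (iffP idP) => /rep; apply. Qed.

(** Only a circuit through x matters: removing x from it leaves an independent
    subset of X, and no basis of X extending that subset can be enlarged by x. *)
Lemma closureP X x : X \subset ground M -> x \in ground M ->
  (x \in closure M X) =
  (x \in X) || [exists D : {set E}, [&& Z D, x \in D & D \subset x |: X]].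
Proof.
move=> XM xM; have [ZM spaceZ rep] := repZ; rewrite inE xM /=.
have xXM : x |: X \subset ground M by rewrite subUset sub1set xM.
case: (boolP (x \in X)) => [xX|xX] /=.
  by rewrite (setUidPr _) ?sub1set // eqxx.
apply/eqP/existsP => [rkx | [D /and3P[ZD xD DX]]].
  have [I [iI _ IX rkI]] := rank_basis (indep0 M) (sub0set X).
  have IM := subset_trans IX XM.
  case: (pickP [pred D : {set E} | [&& Z D, D != set0 & D \subset x |: I]]).
    move=> D /and3P[ZD nD DI]; exists D; rewrite ZD (subset_trans DI) ?setUS //.
    rewrite andbT; apply: contraR nD => xD; apply/eqP.
    apply: (indep_cycleP IM iI) => //; apply/subsetP => y yD.
    have := subsetP DI y yD; rewrite in_setU1 => /orP[/eqP yx|//].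
    by rewrite -yx yD in xD.
  move=> noD; have ixI : indep M (x |: I).
    apply/indep_cycleP => [|D ZD DI]; first exact: subset_trans (setUS _ IX) xXM.
    by apply/eqP/negPn/negP => nD; have := noD D; rewrite /= ZD nD DI.
  have : #|x |: I| <= rank M (x |: X) by rewrite indep_rank ?setUS.
  by rewrite rkx -rkI cardsU1 (contra (subsetP IX x)) // ltnn.
have [C [/min_cycleP[ZC _ minC] xC CD]] := min_cycle_through spaceZ ZD xD.
have CX : C :\ x \subset X.
  apply/subsetP => y; rewrite !inE => /andP[yx yC].
  by have := subsetP (subset_trans CD DX) y yC; rewrite !inE (negPf yx).
have iC : indep M (C :\ x).
  apply/indep_cycleP => [|B ZB BC]; first exact: subset_trans CX XM.
  apply/eqP/negPn/negP => nB.
  have eqB := minC B ZB nB (subset_trans BC (subsetDl _ _)).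
  by have := subsetP BC x; rewrite eqB xC !inE eqxx => /(_ isT).
have [B [iB CB BX rkB]] := rank_basis iC CX.
apply/eqP; rewrite eqn_leq (rankS (subsetUr _ _)) andbT.
rewrite leqNgt -rkB; apply/negP => lt.
have [J [iJ _ JX rkJ]] := rank_basis (indep0 M) (sub0set (x |: X)).
rewrite -rkJ in lt.
have [y /setDP[yJ yB] iyB] := indep_aug iB iJ lt.
have := subsetP JX y yJ; rewrite in_setU1 => /orP[/eqP yx|yX]; last first.
  have : #|y |: B| <= rank M X by rewrite indep_rank // subUset sub1set yX.
  by rewrite cardsU1 yB -rkB ltnn.
have C0 : C = set0.
  apply: (indep_cycleP _ iyB) => //.
    by rewrite subUset sub1set yx xM (subset_trans BX).
  apply/subsetP => z zC; rewrite in_setU1 yx; case: eqP => //= zx.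
  by apply: (subsetP CB); rewrite !inE zC andbT; apply/eqP.
by rewrite C0 inE in xC.
Qed.

End RankClosure.

(** * Minimal cycles through a fixed element *)

Section CycleSpaceConnectivity.

Variables (T : finType) (Z : pred {set T}) (spaceZ : cycle_space Z).
Implicit Types (A C D : {set T}).

(** Removing a minimal cycle contained in D leaves a smaller cycle. *)
Lemma cycle_space_ind (P : {set T} -> Prop) :
  P set0 ->
  (forall C D, min_cycle Z C -> Z D -> P D -> P (symdiff D C)) ->
  forall D, Z D -> P D.
Proof.
move=> P0 PS D; have [k] := ubnP #|D|; elim: k D => // k IHk D ltD ZD.
have [->//|[x xD]] := set_0Vmem D.
have [C [minC xC CD]] := min_cycle_through spaceZ ZD xD.
have [ZC _ _] := min_cycleP _ _ minC.
have ZDC : Z (symdiff D C) by rewrite cycle_space_symdiffr.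
rewrite -(symdiffK D C); apply: PS => //; apply: IHk => //.
apply: leq_trans (_ : #|D| <= k); last by lia.
apply/proper_card/properP; split; last first.
  by exists x; rewrite // in_symdiff xD xC.
apply/subsetP => y; rewrite in_symdiff.
by case: (boolP (y \in C)) => [/(subsetP CD) -> // | _]; rewrite addbF.
Qed.

(** Among the minimal cycles through a that meet D, take A with A - D least. The
    part A2 through a of the sum of A and D then satisfies A2 - D = A - D, so the
    rest of that sum is a cycle inside D. By minimality of D it is empty or D,
    and it is not D because it misses the elements common to A and D. *)
Lemma min_cycle_symdiff a D A : min_cycle Z D -> a \notin D ->
  min_cycle Z A -> a \in A -> A :&: D != set0 ->
  exists A1 A2, [/\ min_cycle Z A1 /\ a \in A1, min_cycle Z A2 /\ a \in A2
                  & D = symdiff A1 A2].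
Proof.
move=> minD aD minA0 aA0 AD0.
pose P := [pred B : {set T} | [&& min_cycle Z B, a \in B & B :&: D != set0]].
have PA0 : P A by rewrite /= minA0 aA0.
have [{AD0 aA0 minA0}A1 /and3P[minA aA AD] leA] :=
  @arg_minnP _ A P (fun B => #|B :\: D|) PA0.
have [ZA _ onlyA] := min_cycleP _ _ minA.
have [ZD nD onlyD] := min_cycleP _ _ minD.
have ZW : Z (symdiff A1 D) by rewrite cycle_space_symdiffr.
have aW : a \in symdiff A1 D by rewrite in_symdiff aA (negPf aD).
have [A2 [minA2 aA2 A2W]] := min_cycle_through spaceZ ZW aW.
have [ZA2 nA2 onlyA2] := min_cycleP _ _ minA2.
exists A1, A2; split=> //.
suff -> : A2 = symdiff A1 D by rewrite (symdiffC A1 D) symdiffC symdiffK.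
apply/esym/symdiff_eq0/eqP; set W2 := symdiff _ _.
have ZW2 : Z W2 by rewrite cycle_space_symdiffr.
apply/negPn/negP => nW2.
have A2D : A2 :&: D != set0.
  apply/negP => /eqP A2D0; suff eqA : A2 = A1 by rewrite -eqA A2D0 eqxx in AD.
  apply: onlyA => //; apply/subsetP => x xA2.
  have := subsetP A2W x xA2; rewrite in_symdiff.
  by have := in_set0 x; rewrite -A2D0 inE xA2 /= => ->; rewrite addbF.
have sub2 : A2 :\: D \subset A1 :\: D.
  apply/subsetP => x; rewrite !inE => /andP[xD xA2]; rewrite xD /=.
  by have := subsetP A2W x xA2; rewrite in_symdiff (negPf xD) addbF.
have /eqP eqAD : A2 :\: D == A1 :\: D.
  by rewrite eqEcard sub2 leA //= minA2 aA2.
have W2D : W2 \subset D.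
  apply/subsetP => x; apply: contraTT => xD; rewrite !in_symdiff (negPf xD) addbF.
  by have := in_setD A2 D x; rewrite eqAD in_setD xD /= => ->; rewrite addbb.
have eqW2 := onlyD W2 ZW2 nW2 W2D.
have [x] := set0Pn _ AD; rewrite inE => /andP[xA xD].
have := xD; rewrite -eqW2 !in_symdiff xA xD /=.
move=> xA2; have := subsetP A2W x xA2.
by rewrite in_symdiff xA xD.
Qed.

End CycleSpaceConnectivity.

(** * Consequences of 3-connectivity *)

Section ThreeConnected.

Variables (E : finType) (M : matroid E) (Z : pred {set E}).
Hypotheses (repZ : binary_rep M Z) (connM : connected M 3).
Hypothesis cardM : 4 <= #|ground M|.
Implicit Types (A C D : {set E}).

Let spaceZ : cycle_space Z. Proof. by case: repZ. Qed.
Let ZM D : Z D -> D \subset ground M. Proof. by case: repZ => ZM _ _; exact: ZM. Qed.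

(** A dependent set D has rank below its size, so if it had at most two elements
    it would be a side of a separation of order equal to its size. *)
Lemma cycle_card D : Z D -> D != set0 -> 2 < #|D|.
Proof.
move=> ZD nD; rewrite ltnNge; apply/negP => le2.
apply: (connM (k := #|D|) (X := D)).
  by rewrite card_gt0 nD ltnS.
have cardC : #|ground M :\: D| = #|ground M| - #|D|.
  by rewrite cardsD (setIidPr (ZM ZD)).
split=> //; [exact: ZM | by rewrite cardC; lia |].
have rkD : rank M D < #|D|.
  rewrite -(prednK (_ : 0 < #|D|)) ?card_gt0 // ltnS.
  apply: rank_le => I iI ID.
  rewrite -ltnS prednK ?card_gt0 //; apply: proper_card; rewrite properEneq ID andbT.
  apply: contraNneq nD => eqI; apply/eqP.
  by apply: (indep_cycleP repZ _ iI) => //; rewrite eqI // ZM.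
have := rankS M (subsetDl (ground M) D); lia.
Qed.

(** An element on no cycle is a coloop, which is a side of a 1-separation. *)
Lemma exists_cycle x : x \in ground M -> exists2 D, Z D & x \in D.
Proof.
move=> xM; case: (pickP [pred D : {set E} | Z D && (x \in D)]).
  by move=> D /andP[]; exists D.
move=> noD; exfalso; apply: (connM (k := 1) (X := [set x])) => //.
have cardC : #|ground M :\: [set x]| = #|ground M| - 1.
  by rewrite cardsD (setIidPr _) ?sub1set // cards1.
split; rewrite ?sub1set ?cards1 ?cardC //; first lia.
have [I [iI _ IX rkI]] := rank_basis (indep0 M) (sub0set (ground M :\: [set x])).
have xI : x \notin I by apply: contraTN xM => /(subsetP IX); rewrite !inE eqxx.
have IM : x |: I \subset ground M.
  by rewrite subUset sub1set xM (subset_trans IX) ?subsetDl.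
have : #|x |: I| <= rank M (ground M).
  apply: indep_rank => //; apply/(indep_cycleP repZ IM) => D ZD DI.
  apply: (indep_cycleP repZ _ iI) => //; first exact: indep_ground iI.
  apply/subsetP => y yD; have := subsetP DI y yD; rewrite in_setU1.
  by case/orP => // /eqP yx; have := noD D; rewrite /= ZD -yx yD.
have := rank_le_card M [set x]; rewrite cardsU1 xI cards1 rkI; lia.
Qed.

(** If all cycles met {a, b} in zero or two elements, deleting both elements
    would lower the rank, and {a, b} would be a side of a 2-separation. *)
Lemma no_series_pair a b : a \in ground M -> b \in ground M -> a != b ->
  ~ (forall D, Z D -> (a \in D) = (b \in D)).
Proof.
move=> aM bM ab pair; apply: (connM (k := 2) (X := [set a; b])) => //.
have abM : [set a; b] \subset ground M by rewrite subUset !sub1set aM.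
have cardC : #|ground M :\: [set a; b]| = #|ground M| - 2.
  by rewrite cardsD (setIidPr abM) cards2 ab.
split; rewrite // ?cardC ?cards2 ?ab //; first lia.
have [I [iI _ IX rkI]] :=
  rank_basis (indep0 M) (sub0set (ground M :\: [set a; b])).
have aI : a \notin I by apply/negP => /(subsetP IX); rewrite !inE eqxx.
have bI : b \notin I by apply/negP => /(subsetP IX); rewrite !inE eqxx orbT.
have IM : a |: I \subset ground M.
  by rewrite subUset sub1set aM (subset_trans IX) ?subsetDl.
have : #|a |: I| <= rank M (ground M).
  apply: indep_rank => //; apply/(indep_cycleP repZ IM) => D ZD DI.
  apply: (indep_cycleP repZ _ iI) => //; first exact: indep_ground iI.
  have bD : b \notin D.
    by apply/negP => /(subsetP DI); rewrite in_setU1 (negPf bI) eq_sym (negPf ab).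
  apply/subsetP => y yD; have := subsetP DI y yD; rewrite in_setU1.
  by case/orP => // /eqP yx; rewrite -pair // -yx yD in bD.
have := rank_le_card M [set a; b]; rewrite (cardsU1 a I) aI cards2 ab rkI; lia.
Qed.

End ThreeConnected.

(** * A flat circuit through one element of a triangle *)

Section AvoidingCycle.

Variables (E : finType) (M : matroid E) (Z : pred {set E}) (a b c : E).
Hypotheses (repZ : binary_rep M Z) (connM : connected M 3).
Hypothesis cardM : 4 <= #|ground M|.
Hypotheses (Ztri : Z [set a; b; c]) (card_tri : #|[set a; b; c]| = 3).
Implicit Types (A C D : {set E}).

Let spaceZ : cycle_space Z. Proof. by case: repZ. Qed.
Let ZM D : Z D -> D \subset ground M. Proof. by case: repZ => ZM _ _; exact: ZM. Qed.

Lemma card3_neq (T : finType) (x y z : T) : #|[set x; y; z]| = 3 ->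
  [/\ x != y, x != z & y != z].
Proof.
rewrite -setUA cardsU1 cards2 !inE.
by case: (x =P y); case: (x =P z); case: (y =P z).
Qed.

Lemma triangle_sub_ground : [/\ a \in ground M, b \in ground M & c \in ground M].
Proof.
by have /subsetP tM := ZM Ztri; rewrite !tM // !inE eqxx ?orbT.
Qed.

Let no_singleton x : ~ Z [set x].
Proof.
have : [set x] != set0 by apply/set0Pn; exists x; rewrite inE.
by move=> n1 /(cycle_card repZ connM cardM) /(_ n1); rewrite cards1.
Qed.

(** The cycle space of M/b\c, obtained by contracting b and deleting c. *)
Definition contract_cycles : pred {set E} :=
  [pred D : {set E} | [&& b \notin D, c \notin D & Z D || Z (b |: D)]].

Lemma setU1_symdiff (x : E) D : x \notin D -> x |: D = symdiff D [set x].
Proof.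
move=> xD; apply/setP => y; rewrite in_symdiff !inE.
by case: (y =P x) => [->|]; rewrite ?(negPf xD) ?addbT ?addbF.
Qed.

Lemma setD1_id (x : E) D : x \notin D -> D :\ x = D.
Proof. by move=> xD; apply/setDidPl; rewrite disjoint_sym disjoints1. Qed.

Lemma contract_cycle_space : cycle_space contract_cycles.
Proof.
have [Z0 ZD] := spaceZ; split=> [|A B]; first by apply/and3P; rewrite !inE Z0.
case/and3P=> bA cA ZA /and3P[bB cB ZB].
have bAB : b \notin symdiff A B by rewrite in_symdiff (negPf bA) (negPf bB).
apply/and3P; split=> //; first by rewrite in_symdiff (negPf cA) (negPf cB).
rewrite setU1_symdiff // in ZA; rewrite setU1_symdiff // in ZB.
rewrite setU1_symdiff //; apply/orP; case/orP: ZA => ZA; case/orP: ZB => ZB;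
  [left | right | right | left]; move: (ZD _ _ ZA ZB); congr (is_true (Z _));
  apply/setP => x; rewrite !in_symdiff;
  by case: (x \in A); case: (x \in B); case: (x \in [set b]).
Qed.

Lemma cycle_contract D : Z D -> c \notin D -> contract_cycles (D :\ b).
Proof.
move=> ZD cD; apply/and3P; rewrite !inE eqxx (negPf cD) andbF; split=> //.
case: (boolP (b \in D)) => bD; first by rewrite setD1K // ZD orbT.
by rewrite setD1_id ?ZD.
Qed.

Lemma contract_cycle_ground D : contract_cycles D -> D \subset ground M.
Proof.
by case/and3P=> _ _ /orP[] /ZM; rewrite // subUset => /andP[].
Qed.

Lemma symdiff_triangle D : Z D ->
  Z (symdiff D [set a; b; c]) /\
  (c \in D -> c \notin symdiff D [set a; b; c]).
Proof.
move=> ZD; rewrite cycle_space_symdiffr //; split=> //.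
by rewrite in_symdiff !inE eqxx orbT => ->.
Qed.

Section Obstruction.

Hypothesis spanning : forall C, Z C -> a \in C ->
  exists D, [/\ Z D, b \in D & D \subset b |: C].

(** If C itself were a cycle of M, it would span b, and by minimality of C the
    cycle showing this would be C with b added, making {b} a cycle. *)
Let min_through C : min_cycle contract_cycles C -> a \in C -> Z (b |: C).
Proof.
move=> /min_cycleP[/and3P[bC cC /orP[ZC|//]] nC minC] aC.
have [D [ZD bD DC]] := spanning ZC aC.
have cD : c \notin D.
  apply/negP => /(subsetP DC); rewrite in_setU1 (negPf cC) orbF eq_sym.
  by have [_ _ /negPf ->] := card3_neq card_tri.
have D3 : 2 < #|D|.
  by apply: (cycle_card repZ) => //; apply/set0Pn; exists b.
have <- : D :\ b = C; last by rewrite setD1K.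
apply: minC (cycle_contract ZD cD) _ _.
  by rewrite -card_gt0; move: D3; rewrite (cardsD1 b) bD; lia.
by rewrite -(setU1K bC) setSD.
Qed.

Let through : {set E} :=
  [set x | (x == a) || [exists A : {set E},
    [&& min_cycle contract_cycles A, a \in A & x \in A]]].

Let throughP x : x != a -> x \in through ->
  exists A, [/\ min_cycle contract_cycles A, a \in A & x \in A].
Proof.
by rewrite inE => /negPf -> /existsP[A /and3P[]]; exists A.
Qed.

Let sub_through A : min_cycle contract_cycles A -> a \in A -> A \subset through.
Proof.
move=> minA aA; apply/subsetP => x xA; rewrite inE; apply/orP; right.
by apply/existsP; exists A; rewrite minA aA.
Qed.

Let through_sum D : min_cycle contract_cycles D -> a \notin D ->
  D :&: through != set0 ->
  exists A1 A2, [/\ min_cycle contract_cycles A1 /\ a \in A1,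
    min_cycle contract_cycles A2 /\ a \in A2 & D = symdiff A1 A2].
Proof.
move=> minD aD /set0Pn[x]; rewrite in_setI => /andP[xD xT].
have xa : x != a by apply: contraTneq xD => ->.
have [A [minA aA xA]] := throughP xa xT.
apply: (min_cycle_symdiff contract_cycle_space minD aD minA aA).
by apply/set0Pn; exists x; rewrite inE xA.
Qed.

(** A circuit that meets the union of the circuits through a is the sum of two of
    them, hence contained in that union. *)
Let min_in_or_out D : min_cycle contract_cycles D ->
  D :&: through = D \/ D :&: through = set0.
Proof.
move=> minD; have [DT|nDT] := eqVneq (D :&: through) set0; [by right|left].
apply/setIidPl; have [aD|aD] := boolP (a \in D); first exact: sub_through.
have [A1 [A2 [[m1 a1] [m2 a2] ->]]] := through_sum minD aD nDT.
apply/subsetP => x; rewrite in_symdiff.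
have [/(subsetP (sub_through m1 a1)) // | _] := boolP (x \in A1).
exact: (subsetP (sub_through m2 a2)).
Qed.

Let cycle_meet_through D : contract_cycles D -> contract_cycles (D :&: through).
Proof.
have [Z0 ZD] := contract_cycle_space.
move: D; apply: (cycle_space_ind contract_cycle_space) => [|C D minC _ ZDT].
  by rewrite set0I.
have -> : symdiff D C :&: through = symdiff (D :&: through) (C :&: through).
  by apply/setP => x; rewrite in_setI !in_symdiff !in_setI -andb_addl.
apply: ZD => //; have [-> | -> //] := min_in_or_out minC.
by case/min_cycleP: minC.
Qed.

Let not_all_through : exists y, [/\ y \in ground M, y \notin through, y != b & y != c].
Proof.
have [ab ac bc] := card3_neq card_tri; have [aM bM cM] := triangle_sub_ground.
case: (pickP [pred y | [&& y \in ground M, y \notin through, y != b & y != c]]).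
  by move=> y /and4P[]; exists y.
move=> none; exfalso.
(* If the circuits through a cover everything, they generate the cycles of
   M/b\c, and by [min_through] a cycle needs b exactly when it contains a. *)
have sign D : contract_cycles D -> Z D = (a \notin D).
  have [Z0 ZD] := spaceZ.
  move: D; apply: (cycle_space_ind contract_cycle_space) => [|C D minC ZbD sgD].
    by rewrite Z0 inE.
  have [ZbC nC _] := min_cycleP _ _ minC.
  have sgC : Z C = (a \notin C).
    have [aC|aC] := boolP (a \in C).
      apply/negP => ZC; have : Z (symdiff (b |: C) C).
        by rewrite cycle_space_symdiffr // min_through.
      have -> : symdiff (b |: C) C = [set b].
        rewrite setU1_symdiff; last by case/and3P: ZbC.
        by rewrite (symdiffC C [set b]) symdiffK.
      by move=> /no_singleton.
    have [x xC] := set0Pn _ nC.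
    have [|A1 [A2 [[m1 a1] [m2 a2] ->]]] := through_sum minC aC.
      apply/set0Pn; exists x; rewrite inE xC; apply/negPn/negP => xT.
      have /and3P[bC cC _] := ZbC; have := none x; rewrite /= xT.
      rewrite (subsetP (contract_cycle_ground ZbC)) //=.
      by case: eqP xC bC => [->->//|_]; case: eqP cC => [->|//] /negPf ->.
    have := ZD _ _ (min_through m1 a1) (min_through m2 a2).
    have -> // : symdiff (b |: A1) (b |: A2) = symdiff A1 A2.
    have [/and3P[b1 _ _] _ _] := min_cycleP _ _ m1.
    have [/and3P[b2 _ _] _ _] := min_cycleP _ _ m2.
    apply/setP => x'; rewrite !in_symdiff !in_setU1.
    by case: eqP => // ->; rewrite (negPf b1) (negPf b2).
  rewrite in_symdiff; move: sgD sgC.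
  case: (boolP (a \in D)); case: (boolP (a \in C)) => /= aC aD sgD sgC.
  - have /and3P[bD _ ] := ZbD; rewrite sgD /= => ZbD'.
    have /and3P[bC _ ] := ZbC; rewrite sgC /= => ZbC'.
    have := ZD _ _ ZbD' ZbC'.
    have -> // : symdiff (b |: D) (b |: C) = symdiff D C.
    apply/setP => x'; rewrite !in_symdiff !in_setU1.
    by case: eqP => // ->; rewrite (negPf bD) (negPf bC).
  - by rewrite cycle_space_symdiffr.
  - by rewrite symdiffC cycle_space_symdiffr.
  - by rewrite cycle_space_symdiffr.
apply: (no_series_pair repZ connM cardM aM bM ab) => D.
have pair D' : Z D' -> c \notin D' -> (a \in D') = (b \in D').
  move=> ZD' cD'; have := sign _ (cycle_contract ZD' cD').
  rewrite !inE ab /=; case: (boolP (b \in D')) => bD'; last first.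
    by rewrite setD1_id // ZD' => /esym/negPf.
  case: (boolP (a \in D')) => //= _ ZD'b.
  have : Z (symdiff D' (D' :\ b)) by rewrite cycle_space_symdiffr.
  have -> : symdiff D' (D' :\ b) = [set b].
    apply/setP => x; rewrite in_symdiff !inE.
    by case: eqP => [->|_] /=; rewrite ?bD' ?addbb.
  by move=> /no_singleton.
move=> ZD; have [cD|cD] := boolP (c \in D); last exact: pair.
have [ZD' cD'] := symdiff_triangle ZD; have := pair _ ZD' (cD' cD).
rewrite !in_symdiff !inE !eqxx !orbT /= !addbT.
by case: (a \in D); case: (b \in D).
Qed.

(** The union of the circuits of M/b\c through a and its complement Y carry all
    circuits of M/b\c separately. Passing back to M by adding b and c to the
    first part raises the connectivity of the partition by at most one, which
    gives a 2-separation; when Y is a single element it would be on no cycle. *)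
Lemma not_all_cycles_spanning : False.
Proof.
have [ab ac bc] := card3_neq card_tri; have [aM bM cM] := triangle_sub_ground.
have [y [yM yT yb yc]] := not_all_through.
pose Y := ground M :\: (through :|: [set b; c]).
have yY : y \in Y by rewrite in_setD yM in_setU (negPf yT) in_set2 (negPf yb) (negPf yc).
have YM : Y \subset ground M by apply: subsetDl.
have Y2 : 1 < #|Y|.
  rewrite ltnNge; apply/negP => le1.
  have eqY x : x \in Y -> x = y.
    by move=> xY; apply: (card_le1_eqP le1).
  have [D [ZD yD cD]] : exists D, [/\ Z D, y \in D & c \notin D].
    have [D ZD yD] := exists_cycle repZ connM cardM yM.
    have [cD|cD] := boolP (c \in D); last by exists D.
    have [ZD' cD'] := symdiff_triangle ZD.
    exists (symdiff D [set a; b; c]); split=> //; last exact: cD'.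
    rewrite in_symdiff yD !inE (negPf yb) (negPf yc) !orbF.
    by apply: contraNN yT => /eqP ->; rewrite inE eqxx.
  have ZbD := cycle_contract ZD cD.
  have [_ ZbS] := contract_cycle_space.
  have := ZbS _ _ ZbD (cycle_meet_through ZbD).
  have -> : symdiff (D :\ b) ((D :\ b) :&: through) = [set y].
    apply/setP => x; rewrite in_symdiff in_setI in_set1.
    have [->|xy] := eqVneq x y.
      by rewrite !in_setD1 yb yD (negPf yT).
    have [xD|//] := boolP (x \in D :\ b); rewrite /=; apply/negbTE.
    apply: contraNN xy => xT; apply/eqP/eqY.
    move: xD; rewrite in_setD1 => /andP[xb xD].
    rewrite in_setD (subsetP (ZM ZD)) // andbT in_setU in_set2 (negPf xb).
    by rewrite negb_or xT /=; apply: contraNneq cD => <-.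
  case/and3P => _ _ /orP[] /(cycle_card repZ connM cardM) lt.
    have : [set y] != set0 by apply/set0Pn; exists y; rewrite inE.
    by move/lt; rewrite cards1.
  have : [set b; y] != set0 by apply/set0Pn; exists b; rewrite !inE eqxx.
  by move/lt; rewrite cards2 eq_sym yb.
pose X := ground M :\: Y.
have bX : b \in X by rewrite !inE bM eqxx orbT.
have cX : c \in X by rewrite !inE cM eqxx !orbT.
have aX : a \in X by rewrite !inE aM eqxx.
apply: (connM (k := 2) (X := Y)) => //; split=> //.
  rewrite -/X (leq_trans _ (subset_leq_card (_ : [set b; c] \subset X))) //.
    by rewrite cards2 bc.
  by rewrite subUset !sub1set bX.
rewrite -/X.
have [I [iI _ IY rkI]] := rank_basis (indep0 M) (sub0set Y).
have i_ab : indep M [set a; b].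
  have abM : [set a; b] \subset ground M by rewrite subUset !sub1set aM.
  apply/(indep_cycleP repZ abM) => D ZD Dab; apply/eqP/negPn/negP => nD.
  have := leq_trans (cycle_card repZ connM cardM ZD nD) (subset_leq_card Dab).
  by rewrite cards2 ab.
have [|J [iJ abJ JX rkJ]] := @rank_basis _ M [set a; b] X i_ab.
  by rewrite subUset !sub1set aX.
have aJ : a \in J by apply: (subsetP abJ); rewrite !inE eqxx.
have bJ : b \in J by apply: (subsetP abJ); rewrite !inE eqxx orbT.
have JM := indep_ground iJ; have IM := indep_ground iI.
have cJ : c \notin J.
  apply/negP => cJ; have tri0 : [set a; b; c] = set0.
    apply: (indep_cycleP repZ JM iJ) => //.
    by rewrite !subUset !sub1set aJ bJ cJ.
  by move: card_tri; rewrite tri0 cards0.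
have IJ0 x : x \in I -> x \notin J.
  move=> /(subsetP IY); apply: contraTN => /(subsetP JX).
  by rewrite in_setD => /andP[].
have KM : (I :|: J) :\ b \subset ground M.
  by rewrite (subset_trans (subsetDl _ _)) // subUset IM.
have cK : #|(I :|: J) :\ b| = #|I| + #|J| - 1.
  have := cardsD1 b (I :|: J); rewrite !inE bJ orbT.
  have := cardsUI I J; have -> : I :&: J = set0.
    apply/setP => x; rewrite !inE; apply/negbTE/negP => /andP[/IJ0 /negP].
    by [].
  by rewrite cards0; clear; lia.
have J0 : 0 < #|J| by rewrite card_gt0; apply/set0Pn; exists b.
(* Dropping b from the union of bases of the two sides loses one element; what
   remains is independent because the cycles split along the partition. *)
suff /indep_rank/(_ KM) : indep M ((I :|: J) :\ b).
  by rewrite cK -rkI -rkJ; move: J0; clear; lia.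
apply/(indep_cycleP repZ KM) => D ZD DK.
have bD : b \notin D by apply/negP => /(subsetP DK); rewrite !inE eqxx.
have cD : c \notin D.
  apply/negP => /(subsetP DK); rewrite !inE (negPf cJ) orbF => /andP[_ /(subsetP IY)].
  by rewrite !inE eqxx !orbT.
have Db := setD1_id bD.
have := cycle_meet_through (cycle_contract ZD cD); rewrite Db.
have DTJ : D :&: through \subset J.
  apply/subsetP => x; rewrite in_setI => /andP[/(subsetP DK)].
  rewrite in_setD1 in_setU => /andP[_ /orP[/(subsetP IY)|//]].
  by rewrite in_setD in_setU => /andP[/negP nT _] xT; case: nT; rewrite xT.
case/and3P => _ _ /orP[] ZDT; last first.
  have : b |: (D :&: through) = set0.
    by apply: (indep_cycleP repZ JM iJ) => //; rewrite subUset sub1set bJ.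
  by move/setP/(_ b); rewrite !inE eqxx.
have DT0 : D :&: through = set0 by apply: (indep_cycleP repZ JM iJ).
apply: (indep_cycleP repZ IM iI) => //; apply/subsetP => x xD.
have := subsetP DK x xD; rewrite in_setD1 in_setU => /andP[xb /orP[//|/(subsetP JX)]].
rewrite in_setD => /andP[xY xM]; case/negP: xY.
rewrite in_setD xM andbT !in_setU in_set1 (negPf xb) in_set1.
have /negPf -> : x \notin through.
  by apply/negP => xT; have := in_set0 x; rewrite -DT0 in_setI xD xT.
by apply: contraNneq cD => <-.
Qed.

End Obstruction.

End AvoidingCycle.

Section FlatCircuit.

Variables (E : finType) (M : matroid E) (Z : pred {set E}) (a b c : E).
Hypotheses (repZ : binary_rep M Z) (connM : connected M 3).
Hypothesis cardM : 4 <= #|ground M|.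
Hypotheses (Ztri : Z [set a; b; c]) (card_tri : #|[set a; b; c]| = 3).

(** A cycle C of least size among those that contain a and do not span b is a
    minimal cycle. An element g spanned by C splits C into two
    cycles through g, each of which omits at least two elements of C because M is
    simple; the one through a would be a smaller choice. *)
Lemma flat_circuit_exists : exists C : {set E},
  [/\ min_cycle Z C, a \in C, b \notin C
    & forall g D, Z D -> D \subset g |: C -> D \subset C].
Proof.
have [ZM spaceZ _] := repZ.
pose avoids (C : {set E}) := [forall D : {set E},
  Z D ==> (b \in D) ==> ~~ (D \subset b |: C)].
pose P := [pred C : {set E} | [&& Z C, a \in C & avoids C]].
have avoidsP C D : avoids C -> Z D -> D \subset b |: C -> b \notin D.
  move=> /forallP/(_ D) + ZD Dsub; rewrite ZD Dsub /=.
  by case: (b \in D).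
have [C0 PC0] : exists C0, P C0.
  have [C PC|none] := pickP P; first by exists C.
  exfalso; apply: (not_all_cycles_spanning repZ connM cardM Ztri card_tri).
  move=> C ZC aC; have := none C; rewrite /= ZC aC /=.
  move=> /negbT; rewrite negb_forall => /existsP[D].
  by rewrite !negb_imply => /and4P[ZD bD DC _]; exists D.
have [C {C0 PC0} /and3P[ZC aC avC] leC] :=
  @arg_minnP _ C0 P (fun C : {set E} => #|C|) PC0.
have bC : b \notin C by apply: (avoidsP C) => //; apply: subsetUr.
have minC : min_cycle Z C.
  have [C' [minC' aC' C'C]] := min_cycle_through spaceZ ZC aC.
  have ZC' : Z C' by case/min_cycleP: minC'.
  suff /leC le : P C' by have <- : C' = C by apply/eqP; rewrite eqEcard C'C.
  rewrite /= ZC' aC' /=; apply/forallP => D; apply/implyP => ZD.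
  apply/implyP => bD; apply/negP => DC'; move: bD; apply/negP.
  by apply: (avoidsP C) => //; apply: subset_trans DC' (setUS _ C'C).
exists C; split=> // g D0 ZD0 D0C; apply/negPn/negP => nD0C.
have gD0 : g \in D0.
  apply: contraR nD0C => gD; apply/subsetP => x xD.
  by have := subsetP D0C x xD; rewrite in_setU1; case: eqP xD gD => [-> ->|].
have gC : g \notin C.
  by apply: contra nD0C => gC; apply: subset_trans D0C _; rewrite subUset sub1set gC /=.
have gb : g != b.
  by apply: contraTneq gD0 => gb; rewrite gb (avoidsP C) // -gb.
(* Of the two cycles into which g splits C, take the one through a. *)
have [D [ZD gD DC aD]] : exists D, [/\ Z D, g \in D, D \subset g |: C & a \in D].
  have [aD0|aD0] := boolP (a \in D0); first by exists D0.
  exists (symdiff D0 C); rewrite cycle_space_symdiffr // !in_symdiff.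
  rewrite gD0 (negPf gC) aC (negPf aD0); split=> //.
  apply/subsetP => x; rewrite in_symdiff in_setU1.
  have [xC|xC] := boolP (x \in C); first by rewrite orbT.
  by rewrite addbF => /(subsetP D0C); rewrite in_setU1 (negPf xC).
have bD : b \notin D.
  by apply/negP => /(subsetP DC); rewrite in_setU1 eq_sym (negPf gb) (negPf bC).
have : #|C| <= #|D|.
  apply: leC; rewrite /= ZD aD /=; apply/forallP => B; apply/implyP => ZB.
  apply/implyP => bB; apply/negP => BD.
  (* An element spanned by D is spanned by C, through exchange of g. *)
  pose B' := if g \in B then symdiff B D else B.
  have ZB' : Z B' by rewrite /B'; case: ifP; rewrite ?cycle_space_symdiffr.
  have /negP : b \notin B'.
    apply: (avoidsP C) => //; rewrite /B'; case: ifPn => gB.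
      apply/subsetP => x; rewrite in_symdiff in_setU1.
      have [->|xg] := eqVneq x g; first by rewrite gB gD.
      have [/(subsetP DC)|xD] := boolP (x \in D).
        by rewrite in_setU1 (negPf xg) /= => ->; rewrite orbT.
      by rewrite addbF => /(subsetP BD); rewrite in_setU1 (negPf xD) orbF => ->.
    apply/subsetP => x xB; have := subsetP BD x xB; rewrite !in_setU1.
    case/orP => [->//|/(subsetP DC)]; rewrite in_setU1.
    by case: eqP xB gB => [-> ->|_ _ _ /= ->] //; rewrite orbT.
  by apply; rewrite /B'; case: ifP; rewrite ?in_symdiff bB ?(negPf bD).
have : 2 < #|symdiff C D|.
  apply: (cycle_card repZ) => //; first by rewrite cycle_space_symdiffr.
  by apply/set0Pn; exists g; rewrite in_symdiff gD (negPf gC).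
have -> : symdiff C D = g |: (C :\: D).
  apply/setP => x; rewrite in_symdiff in_setU1 in_setD.
  have [->|xg] := eqVneq x g; first by rewrite gD (negPf gC).
  have [/(subsetP DC)|] := boolP (x \in D); rewrite ?addbF ?andbT //=.
  by rewrite in_setU1 (negPf xg) /= => ->.
have eqD : D = g |: (C :&: D).
  apply/setP => x; rewrite in_setU1 in_setI.
  have [->|xg] := eqVneq x g; first by rewrite gD.
  have [/(subsetP DC)|] := boolP (x \in D); rewrite ?andbF ?andbT //=.
  by rewrite in_setU1 (negPf xg).
have := cardsID D C.
rewrite [X in _ -> _ -> _ <= X -> _](congr1 (fun B : {set E} => #|B|) eqD).
rewrite (cardsU1 g (C :&: D)) (cardsU1 g (C :\: D)) !inE (negPf gC) andbF /=.
by clear; lia.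
Qed.

End FlatCircuit.

(** * The arcs of the spokes form a chain *)

Section RationalKernel.

Local Open Scope ring_scope.

Variables (E : finType) (M : matroid E) (Z : pred {set E}).
Hypothesis repZ : binary_rep M Z.
Variables (V : lmodType rat) (psi : E -> V).
Hypothesis repQ : vector_rep M psi.

Definition dependency (w : E -> rat) : Prop := \sum_x w x *: psi x = 0.

Lemma dependency_lin (k1 k2 : rat) w1 w2 : dependency w1 -> dependency w2 ->
  dependency (fun x => k1 * w1 x + k2 * w2 x).
Proof.
move=> d1 d2; rewrite /dependency.
under eq_bigr => x _ do rewrite scalerDl -!scalerA.
by rewrite big_split /= -!scaler_sumr d1 d2 !scaler0 addr0.
Qed.

(** The support of a nontrivial relation is dependent. *)
Lemma dependency_cycle w : dependency w -> (exists x, w x != 0) ->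
  forall I : {set E}, I \subset ground M -> (forall x, w x != 0 -> x \in I) ->
  exists D, [/\ Z D, D != set0 & forall x, x \in D -> w x != 0].
Proof.
move=> dw [x wx] I IM suppI; pose S := [set y | w y != 0].
have SM : S \subset ground M.
  by apply: subset_trans IM; apply/subsetP => y; rewrite inE => /suppI.
case: (pickP [pred D : {set E} | [&& Z D, D != set0 & D \subset S]]).
  move=> D /and3P[ZD nD /subsetP DS]; exists D; split=> // y /DS.
  by rewrite inE.
move=> none; have iS : indep M S.
  apply/(indep_cycleP repZ SM) => D ZD DS; apply/eqP/negPn/negP => nD.
  by have := none D; rewrite /= ZD nD DS.
have [free_S _] := repQ SM.
case/eqP: wx; apply: (free_S iS) => // y; rewrite inE negbK.
by move/eqP.
Qed.

(** A relation on a circuit cannot vanish at any of its elements, its support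
    being dependent. *)
Lemma circuit_dependency C : min_cycle Z C ->
  exists w, dependency w /\ forall x, (w x != 0) = (x \in C).
Proof.
have [ZM _ _] := repZ.
move=> /min_cycleP[ZC nC minC]; have CM := ZM _ ZC.
have dC : ~~ indep M C.
  apply/negP => iC; case/eqP: nC; exact: (indep_cycleP repZ CM iC).
have [_ /(_ dC)[w [w0 dw nw]]] := repQ CM; exists w; split=> //.
have suppC x : w x != 0 -> x \in C by apply: contraR => /w0 ->.
have [D [ZD nD Dw]] := dependency_cycle dw nw CM suppC.
have <- : D = C by apply: minC => //; apply/subsetP => x /Dw /suppC.
move=> x; apply/idP/idP => [wx|/Dw //].
have -> : D = C by apply: minC => //; apply/subsetP => y /Dw /suppC.
exact: suppC.
Qed.

Section Circuit.

Variables (a b c : E) (C : {set E}).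
Hypotheses (minC : min_cycle Z C) (aC : a \in C) (bC : b \notin C).
Hypothesis flatC : forall g D, Z D -> D \subset g |: C -> D \subset C.

Let spaceZ : cycle_space Z. Proof. by case: repZ. Qed.
Let ZM D : Z D -> D \subset ground M. Proof. by case: repZ => ZM _ _; exact: ZM. Qed.
Let ZC : Z C. Proof. by case/min_cycleP: minC. Qed.
Let onlyC D : Z D -> D \subset C -> D = set0 \/ D = C.
Proof.
move=> ZD DC; have [->|nD] := eqVneq D set0; [by left | right].
by have [_ _] := min_cycleP _ _ minC; apply.
Qed.

(** The spoke e is the sum of b and of the elements of X over the two-element
    field. As C sums to zero, its subset X is only determined up to
    complementation in C; requiring a to be outside X selects one of the two. The
    symmetric difference makes the condition meaningful for e = b, whose arc is
    empty. *)
Definition arc (e : E) (X : {set E}) : bool :=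
  [&& X \subset C, a \notin X & Z (symdiff (symdiff [set b] [set e]) X)].

Lemma arc_pair e f X Y : arc e X -> arc f Y ->
  Z (symdiff (symdiff [set e] [set f]) (symdiff X Y)).
Proof.
have [_ ZD] := spaceZ.
move=> /and3P[_ _ Ze] /and3P[_ _ Zf]; move: (ZD _ _ Ze Zf).
congr (is_true (Z _)); apply/setP => x; rewrite !in_symdiff.
by case: (x \in [set b]); case: (x \in [set e]); case: (x \in [set f]);
  case: (x \in X); case: (x \in Y).
Qed.

Lemma arc_uniq e X Y : arc e X -> arc e Y -> X = Y.
Proof.
move=> eX eY; have := arc_pair eX eY; rewrite symdiffxx symdiffC symdiff0 => ZXY.
have /and3P[XC aX _] := eX; have /and3P[YC aY _] := eY.
have XYC : symdiff X Y \subset C.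
  by rewrite subUset !(subset_trans (subsetDl _ _)).
have [/symdiff_eq0 //|eqC] := onlyC ZXY XYC.
by have := in_symdiff X Y a; rewrite eqC aC (negPf aX) (negPf aY).
Qed.

Lemma arc_base : arc b set0.
Proof.
by rewrite /arc sub0set inE symdiffxx symdiff0 /=; case: spaceZ.
Qed.

Hypothesis simpleZ : forall D, Z D -> D != set0 -> (2 < #|D|)%N.

Lemma arc_inj e f X : arc e X -> arc f X -> e = f.
Proof.
move=> eX fX; have := arc_pair eX fX; rewrite symdiffxx symdiff0 => Zef.
apply/eqP/negPn/negP => ef.
have nD : symdiff [set e] [set f] != set0.
  by apply/set0Pn; exists e; rewrite in_symdiff !inE eqxx.
have := simpleZ Zef nD; rewrite ltnNge => /negP; apply.
apply: (@leq_trans #|[set e; f]|); last by rewrite cards2 ef.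
apply: subset_leq_card; apply/subsetP => x; rewrite in_symdiff !inE.
by case: (x == e); case: (x == f).
Qed.

(** As C is a flat, a cycle expressing e through b and C must use b. *)
Lemma arc_closure e : b \in ground M -> e \in closure M (b |: C) ->
  e \notin C -> exists X, arc e X.
Proof.
move=> bM eF eC.
have bCM : b |: C \subset ground M by rewrite subUset sub1set bM ZM.
have eM : e \in ground M by move: eF; rewrite inE => /andP[].
move: eF; rewrite (closureP repZ) // in_setU1 (negPf eC) orbF.
case/orP => [/eqP -> | /existsP[D /and3P[ZD eD DF]]].
  by exists set0; apply: arc_base.
have [->|eb] := eqVneq e b; first by exists set0; apply: arc_base.
have bD : b \in D.
  apply/negPn/negP => bD; case/negP: eC; apply: (subsetP (flatC (g := e) ZD _)) => //.
  apply/subsetP => x xD; have := subsetP DF x xD; rewrite !in_setU1.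
  case/or3P => [->//|/eqP xb|->]; last by rewrite orbT.
  by rewrite -xb xD in bD.
pose X0 := (D :\ b) :\ e.
have ZX0 : Z (symdiff (symdiff [set b] [set e]) X0).
  move: ZD; congr (is_true (Z _)); apply/setP => x; rewrite !in_symdiff !inE.
  have [->|xb] := eqVneq x b; first by rewrite eq_sym (negPf eb) bD.
  by have [->|xe] := eqVneq x e; rewrite ?eD.
have X0C : X0 \subset C.
  apply/subsetP => x; rewrite !inE => /and3P[xe xb /(subsetP DF)].
  by rewrite !inE (negPf xe) (negPf xb).
have [aX|aX] := boolP (a \in X0); last by exists X0; rewrite /arc X0C aX.
exists (symdiff X0 C); apply/and3P; split.
- apply/subsetP => x; rewrite in_symdiff.
  by have [/(subsetP X0C)|] := boolP (x \in X0).
- by rewrite in_symdiff aX aC.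
rewrite -(cycle_space_symdiffr spaceZ _ ZC); move: ZX0.
congr (is_true (Z _)); apply/setP => x; rewrite !in_symdiff.
by case: (x \in C); case: (x \in X0); case: (x \in [set b]); case: (x \in [set e]).
Qed.

(** As C is a flat, a cycle using one of e and f uses both, and two such cycles
    differ by a cycle inside C, that is, by the empty set or C. *)
Lemma two_spoke_circuit e f (D : {set E}) : e \notin C -> f \notin C -> e != f ->
  D \subset C -> D != set0 -> D != C -> Z ([set e; f] :|: D) ->
  min_cycle Z ([set e; f] :|: D).
Proof.
move=> eC fC ef DC nD DneC ZU; set U := _ :|: D.
have inU x : x \in C -> (x \in U) = (x \in D).
  move=> xC; rewrite !inE.
  by case: eqP xC eC => [-> -> //|_ xC _]; case: eqP xC fC => [-> ->|].
have eU : e \in U by rewrite !inE eqxx.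
have fU : f \in U by rewrite !inE eqxx orbT.
apply/min_cycleP; split=> // [|B ZB nB BU]; first by apply/set0Pn; exists e.
have sub x : x \in B -> [|| x == e, x == f | x \in C].
  move=> /(subsetP BU); rewrite !inE -orbA => /or3P[->|->|/(subsetP DC) ->] //;
  by rewrite ?orbT.
have eqef : (e \in B) = (f \in B).
  apply/idP/idP => [eB|fB]; apply: contraTT (isT) => nB'.
    suff /subsetP/(_ e eB) : B \subset C by rewrite (negPf eC).
    apply: (flatC (g := e) ZB); apply/subsetP => x xB; rewrite in_setU1.
    case/or3P: (sub x xB) => [->//|/eqP xf|->]; last by rewrite orbT.
    by rewrite -xf xB in nB'.
  suff /subsetP/(_ f fB) : B \subset C by rewrite (negPf fC).
  apply: (flatC (g := f) ZB); apply/subsetP => x xB; rewrite in_setU1.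
  case/or3P: (sub x xB) => [/eqP xe|->//|->]; last by rewrite orbT.
  by rewrite -xe xB in nB'.
have subU x : x \in U -> [|| x == e, x == f | x \in C].
  rewrite !inE -orbA => /or3P[->|->|/(subsetP DC) ->] //; by rewrite ?orbT.
have [eB|eB] := boolP (e \in B).
  have fB : f \in B by rewrite -eqef.
  have ZBU : Z (symdiff B U) by rewrite cycle_space_symdiffr.
  have BUC : symdiff B U \subset C.
    apply/subsetP => x; rewrite in_symdiff.
    have [->|xe] := eqVneq x e; first by rewrite eB eU.
    have [->|xf] := eqVneq x f; first by rewrite fB fU.
    have [/subU|_] := boolP (x \in U); first by rewrite (negPf xe) (negPf xf).
    by rewrite addbF => /sub; rewrite (negPf xe) (negPf xf).
  have [/symdiff_eq0 //|eqC] := onlyC ZBU BUC.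
  have [d dD] := set0Pn _ nD.
  have dC := subsetP DC d dD; case/eqP: DneC.
  apply/eqP; rewrite eqEsubset DC; apply/subsetP => x xC.
  have := in_symdiff B U x; rewrite eqC xC.
  have [xB _|_ /= eqU] := boolP (x \in B); last by rewrite -inU // -eqU.
  by rewrite -inU // (subsetP BU).
have fB : f \notin B by rewrite -eqef.
have BC : B \subset C.
  apply/subsetP => x xB; case/or3P: (sub x xB) => // /eqP eqx.
    by rewrite -eqx xB in eB.
  by rewrite -eqx xB in fB.
have [B0|eqB] := onlyC ZB BC; first by rewrite B0 eqxx in nB.
case/eqP: DneC; apply/eqP; rewrite eqEsubset DC; apply/subsetP => x xC.
by rewrite -inU // (subsetP BU) // eqB.
Qed.

Variable kappa : E -> rat.
Hypotheses (dkappa : dependency kappa) (suppk : forall x, (kappa x != 0) = (x \in C)).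

(** Subtracting the multiple of kappa that agrees with w at a leaves a relation
    vanishing at a. Its support would contain a cycle, which lies in C because C
    is a flat, and so would be C itself, in spite of a. *)
Lemma dependency_flat f w : dependency w -> f \in ground M -> f \notin C ->
  (forall x, w x != 0 -> x \in f |: C) ->
  exists m, forall x, w x = m * kappa x.
Proof.
move=> dw fM fC suppw; have ka : kappa a != 0 by rewrite suppk.
exists (w a / kappa a) => x; pose v x := 1 * w x + (- (w a / kappa a)) * kappa x.
suff : v x = 0 by rewrite /v mul1r mulNr => /eqP; rewrite subr_eq0 => /eqP.
apply/eqP/negPn/negP => vx.
have dv : dependency v by apply: dependency_lin.
have va : v a = 0 by rewrite /v mul1r mulNr divfK // subrr.
have fCM : f |: C \subset ground M by rewrite subUset sub1set fM ZM.
have vC y : v y != 0 -> y \in f |: C.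
  apply: contraR => yC; have /negPn/eqP wy := contra (suppw y) yC.
  have ky : kappa y = 0.
    by apply/eqP/negPn; rewrite suppk; apply: contra yC; rewrite in_setU1 orbC => ->.
  by rewrite /v wy ky !mulr0 addr0.
have [D [ZD nD Dv]] := dependency_cycle dv (ex_intro _ x vx) fCM vC.
have DC : D \subset C.
  by apply: (flatC (g := f) ZD); apply/subsetP => y /Dv /vC.
have [D0|eqD] := onlyC ZD DC; first by rewrite D0 eqxx in nD.
by have := Dv a; rewrite eqD aC va eqxx => /(_ isT).
Qed.

(** Both D and its complement in C form a circuit with e and f. Eliminating e
    from the relations of these two circuits leaves a multiple of kappa, and on D
    only the first relation contributes to it. *)
Lemma two_spoke_dependency e f (D : {set E}) : e \notin C -> f \notin C -> e != f ->
  D \subset C -> D != set0 -> D != C -> Z ([set e; f] :|: D) ->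
  exists w l, [/\ dependency w, w e != 0 /\ w f != 0, l != 0
    & forall x, x != e -> x != f -> w x = if x \in D then l * kappa x else 0].
Proof.
move=> eC fC ef DC nD DneC ZU.
have [u [du su]] := circuit_dependency (two_spoke_circuit eC fC ef DC nD DneC ZU).
have ZU' : Z ([set e; f] :|: (C :\: D)).
  rewrite -(cycle_space_symdiffr spaceZ _ ZC); move: ZU.
  congr (is_true (Z _)); apply/setP => x; rewrite in_symdiff !inE.
  have [->|xe] := eqVneq x e; first by rewrite (negPf eC).
  have [->|xf] := eqVneq x f; first by rewrite (negPf fC).
  by have [/(subsetP DC) ->|] := boolP (x \in D); case: (x \in C).
have nD' : C :\: D != set0.
  by apply: contra DneC; rewrite setD_eq0 eqEsubset DC => ->.
have D'C : C :\: D != C.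
  have [d dD] := set0Pn _ nD; apply/eqP => /setP/(_ d).
  by rewrite in_setD dD (subsetP DC).
have [u' [du' su']] :=
  circuit_dependency (two_spoke_circuit eC fC ef (subsetDl _ _) nD' D'C ZU').
have ue : u e != 0 by rewrite su !inE eqxx.
have uf : u f != 0 by rewrite su !inE eqxx orbT.
have u'e : u' e != 0 by rewrite su' !inE eqxx.
have dv : dependency (fun x => u' e * u x + - u e * u' x) by apply: dependency_lin.
have fM : f \in ground M by apply: (subsetP (ZM ZU)); rewrite !inE eqxx orbT.
have [x|m vm] := dependency_flat dv fM fC.
  have [->|xe] := eqVneq x e; first by rewrite mulNr mulrC subrr eqxx.
  apply: contraR; rewrite in_setU1 negb_or => /andP[xf xC].
  have ux : u x = 0.
    apply/eqP/negPn; rewrite su !inE (negPf xe) (negPf xf) /=.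
    by apply: contra xC => /(subsetP DC).
  have u'x : u' x = 0.
    by apply/eqP/negPn; rewrite su' !inE (negPf xe) (negPf xf) (negPf xC) andbF.
  by rewrite ux u'x !mulr0 addr0.
have onD x : x \in D -> u x = m / u' e * kappa x.
  move=> xD; have := vm x; have -> : u' x = 0.
    apply/eqP/negPn; rewrite su' !inE xD /= orbF.
    have xC := subsetP DC x xD.
    by apply/norP; split; apply: contraTneq xC => ->.
  rewrite mulr0 addr0 => eqx; apply: (mulfI u'e); rewrite eqx; field.
  by [].
exists u, (m / u' e); split=> //.
  have [d dD] := set0Pn _ nD; have := onD d dD.
  apply: contra_eq_neq => ->; rewrite mul0r.
  by rewrite su !inE dD orbT.
move=> x xe xf; case: ifPn => [/onD //|xD].
by apply/eqP/negPn; rewrite su !inE (negPf xe) (negPf xf) (negPf xD).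
Qed.

Lemma arc_dependency e f X Y : arc e X -> arc f Y ->
  e \notin C -> f \notin C -> e != f ->
  exists w l, [/\ dependency w, w e != 0 /\ w f != 0, l != 0
    & forall x, x != e -> x != f ->
      w x = if x \in symdiff X Y then l * kappa x else 0].
Proof.
move=> eX fY eC fC ef; apply: two_spoke_dependency => //.
- have /and3P[XC _ _] := eX; have /and3P[YC _ _] := fY.
  by rewrite subUset !(subset_trans (subsetDl _ _)).
- apply/eqP => /symdiff_eq0 eqXY; move: fY; rewrite -eqXY => /(arc_inj eX) eqef.
  by rewrite eqef eqxx in ef.
- have /and3P[_ aX _] := eX; have /and3P[_ aY _] := fY.
  apply/eqP => /setP/(_ a); rewrite in_symdiff aC (negPf aX) (negPf aY).
  by [].
have /and3P[XC _ _] := eX; have /and3P[YC _ _] := fY.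
have := arc_pair eX fY; congr (is_true (Z _)); apply/setP => x.
rewrite in_setU in_set2 !in_symdiff !in_set1.
have [->|xe] := eqVneq x e.
  rewrite (negPf ef) !(contraNF (subsetP _ _) eC) //.
have [->|xf] := eqVneq x f; last by [].
by rewrite !(contraNF (subsetP _ _) fC).
Qed.

(** Normalizing the coefficient of b makes the coefficients l of different
    spokes comparable. *)
Lemma spoke_dependency e X : arc e X -> e \notin C -> e != b ->
  exists u l, [/\ dependency u, u b = 1, l != 0, u e != 0
    & forall x, x != e -> x != b -> u x = if x \in X then l * kappa x else 0].
Proof.
move=> eX eC eb.
have [w [l [dw [we wb] nl suppw]]] := arc_dependency eX arc_base eC bC eb.
exists (fun x => (w b)^-1 * w x + 0 * w x), ((w b)^-1 * l); split.
- exact: dependency_lin.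
- by rewrite mulVf // mul0r addr0.
- by rewrite mulf_neq0 ?invr_neq0.
- by rewrite mul0r addr0 mulf_neq0 ?invr_neq0.
move=> x xe xb; rewrite (suppw x) // symdiff0 mul0r addr0.
by case: ifP; rewrite ?mulr0 // mulrA.
Qed.

(** The difference of the normalized relations of e and f eliminates b. Up to
    the relation on C it is the one carried by e, f and the symmetric difference
    of their arcs; the element a, outside both arcs, shows that no multiple of
    kappa has to be added. *)
Lemma arc_coefficients e f X Y (u v : E -> rat) (k l : rat) :
  arc e X -> arc f Y -> e \notin C -> f \notin C -> e != f -> e != b -> f != b ->
  dependency u -> u b = 1 -> u e != 0 ->
  (forall x, x != e -> x != b -> u x = if x \in X then k * kappa x else 0) ->
  dependency v -> v b = 1 ->
  (forall x, x != f -> x != b -> v x = if x \in Y then l * kappa x else 0) ->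
  exists m, forall x, x \in C ->
    (if x \in X then k else 0) - (if x \in Y then l else 0) =
    if x \in symdiff X Y then m else 0.
Proof.
move=> eX fY eC fC ef eb fb du ub ue suppu dv vb suppv.
have [w [r [dw [we wf] nr suppw]]] := arc_dependency eX fY eC fC ef.
pose s := u e / w e.
(* The multiple s of w is chosen to cancel e; only f and C remain. *)
pose t x := 1 * (1 * u x + (-1) * v x) + (- s) * w x.
have dt : dependency t by do 2 apply: dependency_lin => //.
have XC : X \subset C by case/and3P: eX.
have YC : Y \subset C by case/and3P: fY.
have eY : e \notin Y by apply: contra eC => /(subsetP YC).
have fM : f \in ground M.
  have /and3P[_ _ /ZM/subsetP] := fY; apply.
  rewrite !in_symdiff !in_set1 eqxx (negPf fb).
  by rewrite (contraNF (subsetP YC f)).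
have [x|m tm] := dependency_flat dt fM fC.
  apply: contraR; rewrite in_setU1 negb_or => /andP[xf xC].
  have xX : x \notin X by apply: contra xC => /(subsetP XC).
  have xY : x \notin Y by apply: contra xC => /(subsetP YC).
  have [->|xe] := eqVneq x e.
    by rewrite /t (suppv e) // (negPf eY) mulr0 addr0 !mul1r mulNr divfK // subrr.
  rewrite /t; have -> : w x = 0 by rewrite suppw // in_symdiff (negPf xX) (negPf xY).
  have [->|xb] := eqVneq x b; first by rewrite ub vb; lra.
  by rewrite (suppu x) // (suppv x) // (negPf xX) (negPf xY) !mulr0 !addr0.
have notC x : x \in C -> [/\ x != e, x != f & x != b].
  by move=> xC; split; apply: contraTneq xC => ->.
have m0 : m = 0.
  have [ae af ab] := notC a aC; have ka : kappa a != 0 by rewrite suppk.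
  have /and3P[_ aX _] := eX; have /and3P[_ aY _] := fY.
  have := tm a; rewrite /t (suppu a) // (suppv a) // (suppw a) // in_symdiff.
  rewrite (negPf aX) (negPf aY) /= !mulr0 !addr0.
  by move/esym/eqP; rewrite mulf_eq0 (negPf ka) orbF => /eqP.
exists (s * r) => x xC; have [xe xf xb] := notC x xC.
have kx : kappa x != 0 by rewrite suppk.
apply: (mulIf kx); have := tm x; rewrite m0 mul0r /t (suppu x) // (suppv x) // (suppw x) //.
case: (x \in X); case: (x \in Y); case: (x \in symdiff X Y) => eqt; nra.
Qed.

(** Suppose that p lies in X only and q in Y only, and let k, l and n be the
    coefficients of e, f and c. Comparing e with f at p and q gives k = -l.
    The arc C - a of c contains p and q, so comparing c with e at p and with f
    at q gives k = n and l = n. Hence k = 0, which is absurd in characteristic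
    zero. *)
Lemma arcs_chain e f X Y : arc c (C :\ a) -> c \notin C ->
  arc e X -> arc f Y -> e \notin C -> f \notin C ->
  (X \subset Y) || (Y \subset X).
Proof.
move=> cA cC eX fY eC fC; apply/negPn; rewrite negb_or; apply/negP.
move=> /andP[/subsetPn[p pX pY] /subsetPn[q qY qX]].
have XC : X \subset C by case/and3P: eX.
have YC : Y \subset C by case/and3P: fY.
have aX : a \notin X by case/and3P: eX.
have aY : a \notin Y by case/and3P: fY.
have ef : e != f.
  apply/eqP => eqef; move: fY; rewrite -eqef => /(arc_uniq eX) eqXY.
  by rewrite -eqXY pX in pY.
have eb : e != b.
  apply/eqP => eqeb; move: eX; rewrite eqeb => /(arc_uniq arc_base) eqX.
  by rewrite -eqX inE in pX.
have fb : f != b.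
  apply/eqP => eqfb; move: fY; rewrite eqfb => /(arc_uniq arc_base) eqY.
  by rewrite -eqY inE in qY.
have cb : c != b.
  apply/eqP => eqcb; move: cA; rewrite eqcb => /(arc_uniq arc_base)/setP/(_ p).
  by rewrite !inE (subsetP XC) // andbT; case: eqP pX aX => // -> ->.
have pa : p \in C :\ a.
  by rewrite !inE (subsetP XC) // andbT; apply: contraNneq aX => <-.
have qa : q \in C :\ a.
  by rewrite !inE (subsetP YC) // andbT; apply: contraNneq aY => <-.
have ec : e != c.
  apply/eqP => eqec; move: eX; rewrite eqec => /(arc_uniq cA) eqX.
  by rewrite -eqX qa in qX.
have fc : f != c.
  apply/eqP => eqfc; move: fY; rewrite eqfc => /(arc_uniq cA) eqY.
  by rewrite -eqY pa in pY.
have [u [k [du ub nk ue suppu]]] := spoke_dependency eX eC eb.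
have [v [l [dv vb nl ve suppv]]] := spoke_dependency fY fC fb.
have [w [n [dw wb nn wc suppw]]] := spoke_dependency cA cC cb.
have [m1 eq1] := arc_coefficients eX fY eC fC ef eb fb du ub ue suppu dv vb suppv.
have [m2 eq2] := arc_coefficients eX cA eC cC ec eb cb du ub ue suppu dw wb suppw.
have [m3 eq3] := arc_coefficients fY cA fC cC fc fb cb dv vb ve suppv dw wb suppw.
have := eq1 p (subsetP XC p pX); have := eq1 q (subsetP YC q qY).
have := eq2 p (subsetP XC p pX); have := eq3 q (subsetP YC q qY).
rewrite !in_symdiff pX (negPf pY) qY (negPf qX) pa qa /=.
by move=> h1 h2 h3 h4; move: nk; rewrite (_ : k = 0) ?eqxx //; lra.
Qed.

End Circuit.

End RationalKernel.

(** * Cycles of a graph as minimal even edge sets *)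

Section CyclicIndices.

Lemma ordS_neq n (i : 'I_n) : 1 < n -> ordS i != i.
Proof.
move=> n1; rewrite -val_eqE /=.
have [lt|ge] := ltnP i.+1 n; first by rewrite modn_small // neq_ltn ltnSn orbT.
have -> : i.+1 = n by apply/eqP; rewrite eqn_leq ge ltn_ord.
by rewrite modnn; move: (ltn_ord i); lia.
Qed.

Lemma ordS_ind n (P : pred 'I_n) i :
  P i -> (forall j, P j -> P (ordS j)) -> forall j, P j.
Proof.
move=> Pi PS j.
have iterP k : P (iter k (@ordS n) i) by elim: k => //= k; apply: PS.
have val_iter k : val (iter k (@ordS n) i) = (i + k) %% n.
  elim: k => [|k IHk]; first by rewrite addn0 modn_small.
  by rewrite iterS /= IHk -addn1 modnDml addn1 addnS.
have -> : j = iter (n - i + j) (@ordS n) i.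
  apply: val_inj; rewrite val_iter addnA subnKC; last exact: ltnW.
  by rewrite modnDl modn_small.
exact: iterP.
Qed.

End CyclicIndices.

Section EvenSets.

Variables (V E : finType) (G : mgraph V E).
Hypothesis loopless : forall x, x \in edges G -> #|ends G x| = 2.
Implicit Types (C D : {set E}).

Definition incidence (x : E) : {ffun V -> 'F_2} := [ffun v => (v \in ends G x)%:R]%R.

Definition even_set : pred {set E} :=
  [pred D : {set E} | (D \subset edges G) && zero_sum incidence D].

Lemma addff_incidence (u : {ffun V -> 'F_2}) : (u + u = 0)%R.
Proof.
apply/ffunP => v; rewrite !ffunE.
by case: (u v) => [[|[|k]] lt]; apply/val_inj.
Qed.

Lemma even_cycle_space : cycle_space even_set.
Proof.
have [Z0 ZD] := zero_sum_cycle_space incidence addff_incidence.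
split=> [|A B /andP[AG ZA] /andP[BG ZB]]; rewrite /even_set /= ?sub0set //.
by rewrite ZD // andbT subUset !(subset_trans (subsetDl _ _)).
Qed.

Lemma zero_sum_evenP D :
  reflect (forall v, ~~ odd #|[set x in D | v \in ends G x]|)
          (zero_sum incidence D).
Proof.
have coordE v : ((\sum_(x in D) incidence x) v
    = #|[set x in D | v \in ends G x]|%:R)%R.
  rewrite sum_ffunE -sum1_card natr_sum big_mkcond [RHS]big_mkcond /=.
  apply: eq_bigr => x _; rewrite inE ffunE.
  by case: (x \in D) => //=; case: (v \in _).
have oddE k : (k%:R == 0 :> 'F_2)%R = ~~ odd k.
  by rewrite -(dvdn_pcharf (pchar_Fp (isT : prime 2))) dvdn2.
apply: (iffP eqP) => [sum0 v | even].
  by rewrite -oddE -coordE sum0 ffunE.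
by apply/ffunP => v; rewrite coordE ffunE; apply/eqP; rewrite oddE.
Qed.

Section Cycle.

Variables (n : nat) (v : 'I_n -> V) (e : 'I_n -> E).
Hypothesis cyc : ncycle G v e.

Lemma ncycle_gt1 : 0 < n -> 1 < n.
Proof.
case: cyc => injv _ eG endsE n0.
have := loopless (eG (Ordinal n0)); rewrite endsE cards2.
case: eqP => //= neq _; have [//|le1] := ltnP 1 n.
case: neq; congr v; apply: val_inj => /=.
by have -> : n = 1 by apply/eqP; rewrite eqn_leq le1.
Qed.

Lemma ncycle_incident i D : D \subset [set e j | j : 'I_n] ->
  [set x in D | v i \in ends G x] = D :&: [set e i; e (ord_pred i)].
Proof.
case: cyc => injv inje eG endsE /subsetP DC; apply/setP => x; rewrite !inE.
case: (boolP (x \in D)) => //= /DC /imsetP[j _ ->].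
rewrite endsE !inE !(inj_eq injv) !(inj_eq inje) (eq_sym i); congr (_ || _).
by apply/eqP/eqP => [->|->]; rewrite ?ordSK ?ord_predK.
Qed.

Lemma ncycle_even : 0 < n -> even_set [set e i | i : 'I_n].
Proof.
move=> n0; have n1 := ncycle_gt1 n0.
have [injv inje eG endsE] := cyc; apply/andP; split.
  by apply/subsetP => x /imsetP[i _ ->].
apply/zero_sum_evenP => u; case: (pickP (fun i => u == v i)) => [i /eqP ->|nou].
  rewrite ncycle_incident // (setIidPr _); last first.
    by rewrite subUset !sub1set !imset_f.
  rewrite cards2 (inj_eq inje) -{1}[i]ord_predK ordS_neq //.
rewrite (_ : [set _ in _ | _] = set0) ?cards0 //.
apply/setP => x; rewrite !inE; apply/negbTE/negP => /andP[/imsetP[i _ ->]].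
by rewrite endsE !inE !nou.
Qed.

(** Each vertex of the cycle meets exactly two of its edges, so an even subset
    that contains one edge contains the next one. *)
Lemma ncycle_minimal D : even_set D -> D != set0 ->
  D \subset [set e i | i : 'I_n] -> D = [set e i | i : 'I_n].
Proof.
move=> /andP[_ /zero_sum_evenP evenD] /set0Pn[x xD] DC.
have [i0 _ x0] := imsetP (subsetP DC x xD).
apply/eqP; rewrite eqEsubset DC; apply/subsetP => _ /imsetP[j _ ->].
apply: (@ordS_ind n (fun i => e i \in D) i0) => [|i eiD]; first by rewrite -x0.
have := evenD (v (ordS i)); rewrite ncycle_incident // ordSK.
apply: contraR => eSi; rewrite (_ : _ :&: _ = [set e i]) ?cards1 //.
apply/setP => y; rewrite !inE; case: eqP => [->|_].
  by rewrite (negPf eSi) /=; apply/esym/eqP => eqe; rewrite eqe eiD in eSi.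
by case: eqP => [->|_]; rewrite ?eiD ?andbF.
Qed.

End Cycle.

(** By evenness a second edge e2 of D leaves the first vertex z of the walk. It
    either leads to a new vertex, in front of which the walk can be extended, or
    closes a cycle with an initial part of the walk. *)
Lemma graph_cycle_of_walk D z e1 (vs : seq V) (es : seq E) :
  even_set D -> uniq (z :: vs) -> size vs = (size es).+1 ->
  (forall k, k <= size es -> nth e1 (e1 :: es) k \in D /\
     ends G (nth e1 (e1 :: es) k) = [set nth z (z :: vs) k; nth z vs k]) ->
  exists2 C : {set E}, C \subset D & graph_cycle G C.
Proof.
move=> evD; have [DG /zero_sum_evenP evenD] := andP evD.
have [k] := ubnP (#|V| - size vs).
elim: k z e1 vs es => // k IHk z e1 vs es ltk uvs szvs walk.
have [e1D ends1] := walk 0 isT; rewrite /= in e1D ends1.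
have [e2 e2D [e21 ze2]] : exists2 e2, e2 \in D & e2 != e1 /\ z \in ends G e2.
  have := evenD z; rewrite (cardsD1 e1) inE e1D ends1 !inE eqxx /= negbK => odd1.
  have /card_gt0P[e2] := odd_gt0 odd1.
  by rewrite !inE => /and3P[ne e2D ze2]; exists e2.
have [w wz ends2] : exists2 w, w != z & ends G e2 = [set z; w].
  have /eqP/cards2P[p [q [pq eq2]]] := loopless (subsetP DG e2 e2D).
  move: ze2; rewrite eq2 !inE => /orP[] /eqP ->.
    by exists q; rewrite // eq_sym.
  by exists p; rewrite // setUC.
(* The walk gets longer with every new vertex, so this case ends. *)
have [wvs|wvs] := boolP (w \in z :: vs); last first.
  apply: (IHk w e2 (z :: vs) (e1 :: es)); rewrite /= ?szvs //.
  - move/card_uniqP: (uvs) => cvs; have := max_card (mem (w :: z :: vs)).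
    have /card_uniqP -> : uniq (w :: z :: vs) by rewrite cons_uniq wvs.
    by move: ltk szvs => /=; clear; lia.
  - by rewrite wvs; move: uvs.
  move=> [|j] /=; first by rewrite ends2 setUC.
  rewrite ltnS => lej; have ltvs : j < size vs by rewrite szvs.
  rewrite (set_nth_default e1 e2) // (set_nth_default z w) //; last exact: ltnW.
  by rewrite (set_nth_default z w) //; apply: walk.
pose i := index w (z :: vs).
have i_gt0 : 0 < i.
  by rewrite lt0n; apply: contraNneq wz => i0; rewrite -(nth_index z wvs) -/i i0.
have lti : i < size (z :: vs) by rewrite index_mem.
have lei : i <= (size es).+1 by move: lti; rewrite /= szvs.
have nthw : nth z (z :: vs) i = w by rewrite nth_index.
(* The cycle follows the walk from z to w and returns along e2. *)
pose v (j : 'I_i.+1) := nth z (z :: vs) j.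
pose e (j : 'I_i.+1) := if j < i then nth e1 (e1 :: es) j else e2.
have nth_inj j l : j <= i -> l <= i ->
    nth z (z :: vs) j = nth z (z :: vs) l -> j = l.
  move=> ji li /eqP; rewrite nth_uniq //; first (by move/eqP);
  by rewrite (leq_ltn_trans _ lti).
have end_mem j l : j <= i -> l < i ->
    nth z (z :: vs) j \in ends G (nth e1 (e1 :: es) l) -> j = l \/ j = l.+1.
  move=> ji li; have [_ ->] := walk l (leq_trans li lei).
  rewrite !inE => /orP[] /eqP; first by move/nth_inj => ->; [left| |exact: ltnW].
  by move=> eqj; right; apply: (nth_inj j l.+1).
have start_mem l : l < i ->
    nth z (z :: vs) l \in ends G (nth e1 (e1 :: es) l).
  by move=> li; have [_ ->] := walk l (leq_trans li lei); rewrite !inE eqxx.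
have eD j : e j \in D.
  by rewrite /e; case: ifP => // li; have [] := walk j (leq_trans li lei).
exists [set e j | j : 'I_i.+1].
  by apply/subsetP => _ /imsetP[j _ ->].
exists i.+1, v, e; split=> //; split=> [j l eqv|j l eqe|j|j].
- by apply/val_inj/nth_inj => //; rewrite -ltnS; apply: ltn_ord.
- have ji := ltn_ord j; have li := ltn_ord l; apply: val_inj => /=.
  have e2_new l' : l' < i -> e2 = nth e1 (e1 :: es) l' -> False.
    move=> l'i eq2; have := end_mem 0 l' isT l'i; rewrite /= -eq2 ze2.
    by move=> /(_ isT)[] // l0; case/eqP: e21; rewrite eq2 -l0.
  rewrite /e in eqe; move: eqe; case: ltnP => ji'; case: ltnP => li' eqe.
  + have := end_mem j l (ltnW ji') li'; rewrite -eqe start_mem // => /(_ isT).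
    have := end_mem l j (ltnW li') ji'; rewrite eqe start_mem // => /(_ isT).
    by clear; lia.
  + by case: (e2_new j ji').
  + by case: (e2_new l li').
  + by clear -ji li ji' li'; lia.
- exact: (subsetP DG).
rewrite /e /v /=; case: ltnP => ji.
  by rewrite modn_small ?ltnS //; have [_ ->] := walk j (leq_trans ji lei).
have -> : j = i :> nat by apply/eqP; rewrite eqn_leq -ltnS ltn_ord.
by rewrite modnn nthw ends2 setUC.
Qed.

Lemma even_contains_cycle D : even_set D -> D != set0 ->
  exists2 C : {set E}, C \subset D & graph_cycle G C.
Proof.
move=> evD /set0Pn[x xD]; have [DG _] := andP evD.
have /eqP/cards2P[p [q [pq endsx]]] := loopless (subsetP DG x xD).
apply: (@graph_cycle_of_walk D p x [:: q] [::]) => //=.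
  by rewrite inE pq.
by move=> [|k] // _; rewrite endsx.
Qed.

Lemma min_even_graph_cycle C : min_cycle even_set C <-> graph_cycle G C.
Proof.
split=> [/min_cycleP[evC nC minC] | [n [v [e [n0 cyc ->]]]]].
  have [C' C'C gC'] := even_contains_cycle evC nC.
  have [n [v [e [n0 cyc eqC]]]] := gC'.
  suff <- : C' = C by [].
  apply: minC => //; first by rewrite eqC; apply: ncycle_even cyc n0.
  by rewrite eqC; apply/set0Pn; exists (e (Ordinal n0)); apply: imset_f.
apply/min_cycleP; split; first exact: ncycle_even cyc n0.
  by apply/set0Pn; exists (e (Ordinal n0)); apply: imset_f.
exact: (ncycle_minimal cyc).
Qed.

End EvenSets.

(** * Cycles with a hub are enlarged wheels *)

Section SpokedCycles.

Variable E : finType.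
Implicit Types (p q : seq E) (S : {set E}) (h : E -> E).
Implicit Types (G : mgraph (option E) E).

(** The rim edges are listed by p in cyclic order. The vertex between a rim edge
    and its successor is named after the former, so that x runs from
    [Some (prev p x)] to [Some x], and the graph does not depend on the starting
    point of p. The hub is [None], and the spoke s ends at [Some (h s)]. *)
Definition spoked_cycle p S h G : Prop :=
  [/\ verts G = None |: [set Some x | x in p],
      edges G = [set x in p] :|: S,
      forall x, x \in p -> ends G x = [set Some x; Some (prev p x)]
    & forall s, s \in S -> ends G s = [set None; Some (h s)]].

Lemma spoked_cycle_exists p S h :
  (forall s, s \in S -> s \notin p /\ h s \in p) ->
  exists G, spoked_cycle p S h G.
Proof.
move=> Sp.
pose d (x : E) : {set option E} :=
  if x \in S then [set None; Some (h x)] else [set Some x; Some (prev p x)].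
pose Vs := None |: [set Some x | x in p].
pose Es := [set x in p] :|: S.
have memV x : x \in p -> Some x \in Vs.
  by move=> xp; rewrite in_setU1 imset_f ?orbT.
have dV x : x \in Es -> d x \subset Vs.
  rewrite /d; case: ifPn => [xS _ | xS].
    by have [_ hp] := Sp x xS; rewrite subUset !sub1set memV // in_setU1.
  rewrite !inE (negPf xS) orbF => xp.
  by rewrite subUset !sub1set !memV // mem_prev.
have cd x : x \in Es -> 0 < #|d x| <= 2.
  by move=> _; rewrite /d; case: ifP => _; rewrite cards2; case: (_ != _).
exists (MGraph dV cd); split=> //= [x xp | s sS]; rewrite /d ?sS //.
case: ifP => // /Sp[/negP]; by rewrite xp.
Qed.

Lemma spoked_cycle_ncycle p S h G x0 : uniq p -> spoked_cycle p S h G ->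
  ncycle G (fun i : 'I_(size p) => Some (nth x0 p i))
           (fun i : 'I_(size p) => nth x0 p (ordS i)).
Proof.
move=> up [_ edgesG endsp _].
have injp (i j : 'I_(size p)) : nth x0 p i = nth x0 p j -> i = j.
  by move/eqP; rewrite nth_uniq // => /eqP/val_inj.
split=> [i j [/injp] // | i j /injp/ordS_inj // | i | i].
  by rewrite edgesG !inE mem_nth.
rewrite endsp ?mem_nth // setUC; congr [set Some _; _].
rewrite -[RHS](prev_next up); congr (prev p _).
case: p up {edgesG endsp injp} i => [|y p] up i; first by case: i.
rewrite next_nth mem_nth // index_uniq //=.
have := ltn_ord i; rewrite /= ltnS leq_eqVlt => /orP[/eqP ->|lt].
  by rewrite modnn [RHS]nth_default.
by rewrite modn_small //= (set_nth_default y).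
Qed.

Lemma prev_at_default (x y0 y1 y : E) p : x != y0 -> x != y1 ->
  prev_at x y0 y p = prev_at x y1 y p.
Proof.
move=> /negPf xy0 /negPf xy1; elim: p y => [|z p IHp] y /=; first by rewrite xy0 xy1.
by rewrite IHp.
Qed.

Lemma prev_at_last (x y : E) p : x \notin p -> prev_at x x y p = last y p.
Proof.
elim: p y => [|z p IHp] y /=; first by rewrite eqxx.
by rewrite in_cons negb_or => /andP[/negPf -> /IHp].
Qed.

(** Without a spoke at it, the vertex [Some x] has degree two, its edges being x
    and the successor f of x; in the graph without x, f runs over both. *)
Lemma subdivide_spoked_cycle x f q S h G H : uniq [:: x, f & q] -> x \notin S ->
  spoked_cycle (f :: q) S h G -> spoked_cycle [:: x, f & q] S h H ->
  (forall s, s \in S -> s \notin f :: q) ->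
  subdivide G f x (Some x) H.
Proof.
move=> /= /and3P[xfq fq uq] xS [vG eG endsG spG] [vH eH endsH spH] Sp.
move: (xfq); rewrite in_cons negb_or => /andP[xf xq].
split; split.
- by rewrite eG !inE eqxx.
- by rewrite eG !inE negb_or xS -in_cons xfq.
- rewrite vG in_setU1 /=; apply/imsetP => -[y yfq [eqy]].
  by rewrite eqy yfq in xfq.
- rewrite vH vG setUCA; congr (_ |: _); apply/setP => u; rewrite in_setU1.
  apply/imsetP/orP => [[y]|].
    rewrite in_cons => /orP[/eqP ->|yfq] ->; first by left.
    by right; apply: imset_f.
  case=> [/eqP ->|/imsetP[y yfq ->]]; first by exists x; rewrite ?mem_head.
  by exists y; rewrite // in_cons yfq orbT.
- by rewrite eH eG; apply/setP => y; rewrite !inE -!orbA.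
- exists (Some f), (Some (prev (f :: q) f)); split.
  + by rewrite endsG ?mem_head.
  + rewrite endsH; last by rewrite !inE eqxx orbT.
    by rewrite /= eqxx.
  rewrite endsH ?mem_head //; congr [set _; Some _].
  by rewrite /= (negPf xf) !prev_at_last.
move=> y; rewrite in_setD1 eG in_setU => /andP[yf]; rewrite inE.
have [yfq _ | yfq /= yS] := boolP (y \in f :: q); last first.
  by rewrite spG ?spH.
rewrite endsG // endsH; last by rewrite in_cons yfq orbT.
have yx : y != x by apply: contraNneq xfq => <-.
congr [set _; Some _]; rewrite /= (negPf yf).
exact: prev_at_default.
Qed.

(** A rim all of whose vertices carry a spoke is that of a wheel; the spokes are
    indexed by the rim vertices at which they end. *)
Lemma spoked_cycle_wheel p S h G : uniq p -> 1 < #|S| ->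
  (forall s, s \in S -> h s \in p) ->
  {in S &, injective h} -> {subset p <= [set h s | s in S]} ->
  spoked_cycle p S h G -> wheel G [set x in p] S.
Proof.
move=> up S2 Sp injh ph spG; have [vG eG endsG spokeG] := spG.
have [s0 s0S] : exists s, s \in S by apply/card_gt0P; apply: ltnW.
have szp : 1 < size p.
  rewrite -(card_uniqP up) -(card_in_imset injh) in S2 *.
  apply: leq_trans S2 (subset_leq_card _).
  by apply/subsetP => _ /imsetP[s sS ->]; apply: Sp.
pose s (i : 'I_(size p)) := odflt s0 [pick s | (s \in S) && (h s == nth s0 p i)].
have sP i : s i \in S /\ h (s i) = nth s0 p i.
  rewrite /s; case: pickP => [t /andP[tS /eqP ht] //|none].
  have /imsetP[t tS eqt] := ph _ (mem_nth s0 (ltn_ord i)).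
  by have := none t; rewrite /= tS eqt eqxx.
have cyc := spoked_cycle_ncycle s0 up spG.
exists (size p), None, (fun i => Some (nth s0 p i)), (fun i => nth s0 p (ordS i)), s.
split; split=> //.
- by move=> i; have [sS hs] := sP i; rewrite spokeG // hs.
- rewrite vG; congr (_ |: _); apply/setP => u; apply/imsetP/imsetP.
    by case=> x xp ->; exists (Ordinal (etrans (index_mem x p) xp)); rewrite //= nth_index.
  by case=> i _ ->; exists (nth s0 p i); rewrite ?mem_nth.
- apply/setP => x; rewrite inE; apply/idP/imsetP => [xp | [i _ ->]]; last first.
    by rewrite mem_nth.
  pose i := Ordinal (etrans (index_mem x p) xp : index x p < size p).
  by exists (ord_pred i); rewrite // ord_predK /= nth_index.
apply/setP => t; apply/idP/imsetP => [tS|[i _ ->]]; last by have [] := sP i.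
have hp := Sp t tS.
pose i := Ordinal (etrans (index_mem (h t) p) hp : index (h t) p < size p).
exists i => //; have [sS hs] := sP i; apply: injh => //.
by rewrite hs /= nth_index.
Qed.

(** Rotating p brings a rim vertex without a spoke to the front, where removing
    it undoes a subdivision. The two spokes keep the rim from becoming shorter
    than a 2-cycle. *)
Lemma spoked_cycle_enlarged p S h G : uniq p -> 1 < #|S| ->
  (forall s, s \in S -> s \notin p /\ h s \in p) -> {in S &, injective h} ->
  spoked_cycle p S h G -> enlarged_wheel G [set x in p] S.
Proof.
have [n] := ubnP (size p); elim: n p G => // n IHn p G ltn up S2 Sp injh spG.
have [ph|] := boolP (all [in [set h s | s in S]] p).
  apply: Enlarged_wheel_base; apply: spoked_cycle_wheel spG => //.
    by move=> s /Sp[].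
  exact/allP.
case/allPn => x xp xh.
have [i q eqp] := rot_to xp.
have memq y : (y \in x :: q) = (y \in p) by rewrite -eqp mem_rot.
have uxq : uniq (x :: q) by rewrite -eqp rot_uniq.
have spG' : spoked_cycle (x :: q) S h G.
  have [vG eG endsG spokeG] := spG; split=> //.
  - rewrite vG; congr (_ |: _); apply/setP => u.
    by apply/imsetP/imsetP => -[y yin ->]; exists y; rewrite ?memq // -memq.
  - by rewrite eG; apply/setP => y; rewrite !in_setU !in_set memq.
  by move=> y; rewrite memq => yp; rewrite endsG // -eqp prev_rot.
have -> : [set y in p] = x |: [set y in q].
  by apply/setP => y; rewrite !inE -memq in_cons.
have Spq s : s \in S -> s \notin x :: q /\ h s \in q.
  move=> sS; have [sp hp] := Sp s sS; rewrite memq; split=> //.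
  move: hp; rewrite -memq in_cons => /orP[/eqP hx|//].
  by case/negP: xh; rewrite -hx imset_f.
have szq : 1 < size q.
  have /= /andP[_ uq] := uxq.
  rewrite -(card_uniqP uq); apply: leq_trans S2 _.
  rewrite -(card_in_imset injh); apply: subset_leq_card.
  by apply/subsetP => _ /imsetP[s sS ->]; case: (Spq s sS).
case: q => [|f q] // in eqp memq uxq spG' Spq szq *.
have [|G' spG''] := @spoked_cycle_exists (f :: q) S h.
  by move=> s /Spq[]; rewrite in_cons negb_or => /andP[].
apply: (@Enlarged_wheel_subdivide _ _ G' _ _ f x (Some x)).
- apply: IHn => //.
  + by move/(congr1 size): eqp; rewrite size_rot => eqsz; rewrite eqsz in ltn.
  + by case/andP: uxq.
  by move=> s /Spq[]; rewrite in_cons negb_or => /andP[].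
- by rewrite inE mem_head.
apply: subdivide_spoked_cycle spG'' spG' _ => //.
  by apply/negP => /Spq[]; rewrite mem_head.
by move=> s /Spq[]; rewrite in_cons negb_or => /andP[].
Qed.

End SpokedCycles.

(** * Ordering a chain of sets *)

Section Orderings.

Lemma sorted_down_closed (T : eqType) (N : T -> nat) (P : pred T) (l : seq T) :
  sorted (fun x y => N x <= N y) l ->
  (forall x y, x \in l -> y \in l -> N x <= N y -> P y -> P x) ->
  filter P l = take (count P l) l.
Proof.
elim: l => //= x l IHl path_l down.
have tr : transitive (fun y z => N y <= N z) by move=> u v w; apply: leq_trans.
have /allP le_x := order_path_min tr path_l.
case: ifPn => Px.
  rewrite add1n /= IHl ?(path_sorted path_l) // => y z yl zl.
  by apply: down; rewrite in_cons ?yl ?zl orbT.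
have nP y : y \in l -> ~~ P y.
  move=> yl; apply: contra Px; apply: down; rewrite ?mem_head ?in_cons ?yl ?orbT //.
  exact: le_x.
rewrite add0n (eq_in_filter (a2 := pred0)) => [|y /nP/negPf //].
rewrite (eq_in_count (a2 := pred0)) => [|y /nP/negPf //].
by rewrite filter_pred0 count_pred0 take0.
Qed.

(** Sort A by the number of sets that miss a point. If z lies in X e and y does
    not, then every set containing y contains X e, hence z, so that z is
    missed less often than y. *)
Lemma chain_ordering (T I : finType) (A : {set T}) (S : {set I})
    (X : I -> {set T}) :
  {in S, forall e, X e \subset A} ->
  {in S &, forall e f, (X e \subset X f) || (X f \subset X e)} ->
  exists l : seq T, [/\ uniq l, l =i A
    & {in S, forall e, X e =i take #|X e| l}].
Proof.
move=> XA chainX; pose N x := #|[set e in S | x \notin X e]|.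
pose l := sort (fun x y => N x <= N y) (enum A).
have memA : l =i A by move=> x; rewrite mem_sort mem_enum.
have ul : uniq l by rewrite sort_uniq enum_uniq.
exists l; split=> // e eS x.
have down y z : y \in l -> z \in l -> N y <= N z -> z \in X e -> y \in X e.
  move=> _ _ leN ze; apply: contraLR leN => ye; rewrite -ltnNge.
  apply/proper_card/properP; split; last first.
    by exists e; rewrite inE eS // ze.
  apply/subsetP => f; rewrite !inE => /andP[fS zf]; rewrite fS /=.
  case/orP: (chainX e f eS fS) => [/subsetP/(_ z ze) | /subsetP/(_ y)/contra].
    by rewrite (negPf zf).
  exact.
have := sorted_down_closed (P := [in X e]) (sort_sorted _ _) down.
rewrite -/l => /(_ (fun y z => leq_total _ _)).
have -> : count [in X e] l = #|X e|.
  rewrite -size_filter -(card_uniqP (filter_uniq _ ul)).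
  apply: eq_card => y; rewrite mem_filter memA.
  by case: (boolP (y \in X e)) => //= /(subsetP (XA e eS)).
move=> <-; rewrite mem_filter memA.
by case: (boolP (x \in X e)) => //= /(subsetP (XA e eS)).
Qed.

End Orderings.

(** * Comparing the cycle space of the flat with that of the graph *)

Section Agreement.

Variables (T : finType) (Z1 Z2 : pred {set T}) (B F : {set T}) (w : T -> {set T}).

(** A cycle space on F is determined by its members inside B together with one
    cycle w e for each e outside B with no other element outside B: adding w e
    removes e from a cycle. *)
Lemma cycle_space_agree : cycle_space Z1 -> cycle_space Z2 ->
  (forall e, e \in F :\: B ->
     [/\ Z1 (w e), Z2 (w e), e \in w e & w e \subset e |: B]) ->
  (forall D : {set T}, D \subset B -> Z1 D = Z2 D) ->
  forall D : {set T}, D \subset F :|: B -> Z1 D = Z2 D.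
Proof.
move=> space1 space2 fund agreeB D; have [n] := ubnP #|D :\: B|.
elim: n D => // n IHn D ltn DF.
have [DB|/subsetPn[e eD eB]] := boolP (D \subset B); first exact: agreeB.
have eFB : e \in F :\: B.
  by have := subsetP DF e eD; rewrite in_setD in_setU (negPf eB) orbF.
have [w1 w2 ew wB] := fund e eFB.
rewrite -(cycle_space_symdiffr space1 D w1) -(cycle_space_symdiffr space2 D w2).
apply: IHn; last first.
  apply/subsetP => x; rewrite in_symdiff.
  have [xD _|_ /= /(subsetP wB)] := boolP (x \in D); first exact: (subsetP DF).
  by rewrite in_setU1 in_setU => /orP[/eqP ->|->]; rewrite ?orbT // -in_setU (subsetP DF).
apply: leq_trans (_ : #|D :\: B| <= n); last by move: ltn; clear; lia.
apply/proper_card/properP; split; last first.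
  by exists e; rewrite !in_setD ?eB ?eD // in_symdiff eD ew andbF.
apply/subsetP => x; rewrite !in_setD in_symdiff => /andP[xB]; rewrite xB /=.
have [//|xD /= /(subsetP wB)] := boolP (x \in D).
by rewrite in_setU1 (negPf xB) orbF => /eqP xe; rewrite xe eD in xD.
Qed.

End Agreement.

Section SpokedCycleEvenSets.

Local Open Scope ring_scope.

Variables (E : finType) (p : seq E) (S : {set E}) (h : E -> E).
Variable (G : mgraph (option E) E).
Hypotheses (up : uniq p) (szp : (1 < size p)%N) (spG : spoked_cycle p S h G).

Lemma prev_neq x : x \in p -> prev p x != x.
Proof.
move=> xp; have [i q eqp] := rot_to xp.
have uxq : uniq (x :: q) by rewrite -eqp rot_uniq.
rewrite -(prev_rot i up) eqp.
case: q eqp uxq => [|f q] eqp.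
  by move/(congr1 size): eqp szp; rewrite size_rot => ->.
move=> /andP[xfq _]; move: (xfq); rewrite in_cons negb_or => /andP[/negPf xf xq].
by rewrite /= xf prev_at_last //; apply: contraNneq xfq => <-; apply: mem_last.
Qed.

Lemma spoked_cycle_loopless x : x \in edges G -> #|ends G x| = 2.
Proof.
have [_ -> endsp endsS] := spG; rewrite in_setU inE.
case/orP => [xp | xS]; last by rewrite endsS // cards2.
by rewrite endsp // cards2 (inj_eq Some_inj) eq_sym prev_neq.
Qed.

Let delta (u : option E) : {ffun option E -> 'F_2} := [ffun v => (v == u)%:R].

Lemma incidence_ends x u v : ends G x = [set u; v] -> u != v ->
  incidence G x = delta u + delta v.
Proof.
move=> endsx uv; apply/ffunP => y; rewrite !ffunE endsx in_set2.
have [->|_] := eqVneq y u; first by rewrite (negPf uv) addr0.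
by rewrite add0r.
Qed.

(** The incidence vectors of the consecutive edges of a path telescope. *)
Lemma sum_incidence_path a l j : p = a :: l -> (j <= size l)%N ->
  \sum_(x <- take j l) incidence G x
  = delta (Some (nth a (a :: l) j)) + delta (Some a).
Proof.
move=> eqp; have [_ _ endsp _] := spG.
elim: j => [|j IHj] lej; first by rewrite take0 big_nil addff_incidence.
rewrite (take_nth a) // -cats1 big_cat big_seq1 /= IHj ?(ltnW lej) //.
have xl : nth a l j \in l by rewrite mem_nth.
have xp : nth a l j \in p by rewrite eqp in_cons xl orbT.
have ul : uniq l by move: up; rewrite eqp => /andP[].
have prevx : prev p (nth a l j) = nth a (a :: l) j.
  by rewrite prev_nth xp eqp index_uniq.
rewrite (incidence_ends (endsp _ xp)); last first.
  by rewrite (inj_eq Some_inj) eq_sym prev_neq.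
by rewrite prevx addrC addrA -(addrA (delta _)) addff_incidence addr0.
Qed.

Lemma rim_graph_cycle : graph_cycle G [set x in p].
Proof.
have [x0 x0p] : exists x, x \in p.
  by case: p szp => // x q; exists x; rewrite mem_head.
exists (size p), (fun i : 'I_(size p) => Some (nth x0 p i)).
exists (fun i : 'I_(size p) => nth x0 p (ordS i)); split.
- exact: ltnW.
- exact: spoked_cycle_ncycle spG.
apply/setP => x; rewrite inE; apply/idP/imsetP => [xp | [i _ ->]]; last first.
  by rewrite mem_nth.
pose i := Ordinal (etrans (index_mem x p) xp : (index x p < size p)%N).
by exists (ord_pred i); rewrite // ord_predK /= nth_index.
Qed.

(** Evenness at the hub excludes the single spoke b. *)
Lemma even_rim_spoke b (D : {set E}) : b \in S ->
  D \subset b |: [set x in p] ->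
  even_set G D = (D == set0) || (D == [set x in p]).
Proof.
move=> bS DB; have [_ _ endsp endsS] := spG.
have loopG := spoked_cycle_loopless.
have rimG : min_cycle (even_set G) [set x in p].
  by apply/(min_even_graph_cycle loopG); apply: rim_graph_cycle.
have [evR nR minR] := min_cycleP _ _ rimG.
apply/idP/idP => [evD | /orP[] /eqP -> //]; last by case: (even_cycle_space G).
have DR : D \subset [set x in p].
  apply/subsetP => x xD; have := subsetP DB x xD; rewrite in_setU1.
  case/orP => // /eqP xb; have /andP[_ /zero_sum_evenP/(_ None)] := evD.
  rewrite (_ : [set _ in _ | _] = [set b]) ?cards1 //.
  apply/setP => y; rewrite in_set1 inE; apply/andP/eqP => [[yD] | ->].
    have := subsetP DB y yD; rewrite in_setU1 inE.
    by case/orP => [/eqP //|yp]; rewrite endsp // !inE.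
  by rewrite -xb xD xb endsS // !inE.
by have [//|nD] := eqVneq D set0; apply/eqP/minR.
Qed.

(** The two spokes and the rim path between their ends form a cycle. *)
Lemma even_spoke_path a b e l j (X : {set E}) : p = a :: l ->
  b \in S -> e \in S -> h b = a -> h e = nth a (a :: l) j ->
  (j <= size l)%N -> X =i take j l -> (forall s, s \in S -> s \notin p) ->
  even_set G (symdiff (symdiff [set b] [set e]) X).
Proof.
move=> eqp bS eS hb he lej eqX Sp; have [_ eG _ endsS] := spG.
have ul : uniq l by move: up; rewrite eqp => /andP[].
apply/andP; split.
  apply/subsetP => x; rewrite !in_symdiff !in_set1 eG in_setU inE eqX eqp.
  have [-> _|_] := eqVneq x b; first by rewrite bS orbT.
  have [-> _|_ /= /mem_take xl] := eqVneq x e; first by rewrite eS orbT.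
  by rewrite in_cons xl orbT.
rewrite /zero_sum !sum_symdiff; do ?exact: addff_incidence.
rewrite !big_set1 (eq_bigl _ _ eqX) -big_uniq ?take_uniq //=.
rewrite (sum_incidence_path eqp lej) -he.
rewrite (incidence_ends (endsS b bS)) // (incidence_ends (endsS e eS)) // hb.
set d1 := delta None; set d2 := delta _; set d3 := delta _.
by rewrite (addrACA d1) addff_incidence add0r [d3 + d2]addrC addff_incidence.
Qed.

End SpokedCycleEvenSets.

Lemma restrict_binary_rep (E : finType) (M : matroid E) (Z Z' : pred {set E})
    (F : {set E}) : binary_rep M Z -> cycle_space Z' ->
  (forall D, Z' D = Z D && (D \subset F)) -> binary_rep (restrict M F) Z'.
Proof.
move=> [ZM spaceZ repZ] spaceZ' eqZ; split=> // [D | I IF].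
  by rewrite eqZ => /andP[/ZM DM DF]; rewrite subsetI DM.
have [IM IF'] := subsetIP IF; rewrite /= IF' andbT.
apply: (iff_trans (repZ I IM)); split=> minI D.
  by rewrite eqZ => /andP[ZD _]; apply: minI.
by move=> ZD DI; apply: minI; rewrite // eqZ ZD (subset_trans DI).
Qed.

(** * The enlarged wheel of a triangle *)

Theorem theorem4p7 (E : finType) (M : matroid E) (a b c : E) :
  connected M 3 -> regular M -> 4 <= #|ground M| ->
  triangle M [set a; b; c] ->
  exists F : {set E}, flat M F /\
  exists (V : finType) (W : mgraph V E) (rim spokes : {set E}),
    [/\ enlarged_wheel W rim spokes,
        is_cycle_matroid (restrict M F) W
      & [/\ a \in rim, b \in spokes, c \in spokes
          & graph_triangle W [set a; b; c]]].
Proof.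
move=> connM regM cardM [circ_tri card_tri].
have [m [psi [phi [repQ rep2]]]] := regular_vector_reps regM.
set Z : pred {set E} := [pred D : {set E} | (D \subset ground M) && zero_sum phi D].
have repZ : binary_rep M Z := vector_rep_binary rep2.
have [ZM spaceZ _] := repZ.
have min_tri : min_cycle Z [set a; b; c] by rewrite -(circuit_min_cycle _ repZ).
have [Ztri _ _] := min_cycleP _ _ min_tri.
have [ab ac bc] := card3_neq card_tri.
have [aM bM cM] : [/\ a \in ground M, b \in ground M & c \in ground M].
  exact: triangle_sub_ground repZ Ztri.
have simpleZ D : Z D -> D != set0 -> 2 < #|D| := @cycle_card _ _ _ repZ connM cardM D.
have [C [minC aC bC flatC]] := flat_circuit_exists repZ connM cardM Ztri card_tri.
have [ZC _ _] := min_cycleP _ _ minC.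
have CM := ZM _ ZC.
have cC : c \notin C.
  apply/negP => cC; case/negP: bC.
  apply: (subsetP (flatC b _ Ztri _)); last by rewrite !inE eqxx orbT.
  by rewrite !subUset !sub1set !in_setU1 eqxx aC cC !orbT.
have bCM : b |: C \subset ground M by rewrite subUset sub1set bM.
pose F := closure M (b |: C).
have FM : F \subset ground M by apply/subsetP => x; rewrite inE => /andP[].
have CbF : b |: C \subset F.
  by apply/subsetP => x xC; rewrite (closureP repZ) ?xC // (subsetP bCM).
have CF : C \subset F := subset_trans (subsetUr _ _) CbF.
have bF : b \in F by rewrite (subsetP CbF) ?setU11.
have cF : c \in F.
  rewrite (closureP repZ) //; apply/orP; right; apply/existsP.
  exists [set a; b; c]; rewrite Ztri !inE eqxx orbT /=.
  by rewrite !subUset !sub1set !in_setU1 !eqxx aC !orbT.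
pose S := F :\: C.
have bS : b \in S by rewrite in_setD bC.
have cS : c \in S by rewrite in_setD cC.
pose X e := odflt set0 [pick Y | arc Z a b C e Y].
have arcX e : e \in S -> arc Z a b C e (X e).
  rewrite in_setD => /andP[eC eF]; rewrite /X; case: pickP => [//|none].
  have [Y eY] := arc_closure repZ minC aC flatC bM eF eC.
  by have := none Y; rewrite eY.
have Xb : X b = set0 := arc_uniq repZ minC aC (arcX b bS) (arc_base repZ a b C).
have cA : arc Z a b C c (C :\ a).
  rewrite /arc subsetDl !inE eqxx /=.
  have := cycle_space_symdiffr spaceZ [set a; b; c] ZC; rewrite Ztri.
  congr (Z _ = _); apply/setP => x; rewrite !in_symdiff !inE.
  have [->|xa] := eqVneq x a; first by rewrite aC (negPf ab) (negPf ac).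
  have [->|xb] := eqVneq x b; first by rewrite (negPf bC) (negPf bc).
  by [].
have XCa e : e \in S -> X e \subset C :\ a.
  move=> /arcX/and3P[XC aX _]; apply/subsetP => x xX.
  by rewrite in_setD1 (subsetP XC) // andbT; apply: contraNneq aX => <-.
have chainX : {in S &, forall e f, (X e \subset X f) || (X f \subset X e)}.
  move=> e f eS fS; have := eS; have := fS; rewrite !in_setD.
  move=> /andP[fC _] /andP[eC _].
  have [kappa [dk sk]] := circuit_dependency repZ repQ minC.
  exact: (arcs_chain repZ repQ minC aC bC flatC simpleZ dk sk cA cC
    (arcX e eS) (arcX f fS) eC fC).
have [l [ul meml takel]] := chain_ordering XCa chainX.
have szl : size l = #|C :\ a| by rewrite -(card_uniqP ul); apply: eq_card.
pose p := a :: l.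
have rimC : [set x in p] = C.
  apply/setP => x; rewrite inE in_cons meml in_setD1.
  by have [->|] := eqVneq x a; rewrite ?aC.
have memp x : (x \in p) = (x \in C) by rewrite -rimC in_set.
have up : uniq p by rewrite /p cons_uniq ul andbT meml setD11.
have szp : 1 < size p.
  by rewrite -(card_uniqP up) (eq_card memp); apply/ltnW/simpleZ => //;
    apply/set0Pn; exists a.
have leX e : e \in S -> #|X e| <= size l.
  by move=> eS; rewrite szl; apply/subset_leq_card/XCa.
(* The end of the arc of e; the empty arc ends where the rim edge a does. *)
pose h e := nth a p #|X e|.
have hp e : e \in S -> h e \in p by move=> eS; rewrite mem_nth // ltnS leX.
have Sp e : e \in S -> e \notin p by rewrite memp in_setD => /andP[].
have injh : {in S &, injective h}.
  move=> e f eS fS /eqP; rewrite nth_uniq ?ltnS ?leX // => /eqP eqc.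
  have eqX : X e = X f.
    by apply/setP => x; rewrite takel // eqc -takel.
  by apply: (arc_inj repZ simpleZ (arcX e eS)); rewrite eqX arcX.
have [|G spG] := @spoked_cycle_exists E p S h.
  by move=> s sS; rewrite Sp ?hp.
have [_ edgesG _ _] := spG.
have eG : edges G = F.
  rewrite edgesG rimC; apply/setP => x; rewrite in_setU in_setD.
  by have [/(subsetP CF) ->|] := boolP (x \in C).
have S2 : 1 < #|S|.
  rewrite (leq_trans _ (subset_leq_card (_ : [set b; c] \subset S))) ?cards2 ?bc //.
  by rewrite subUset !sub1set bS.
(* The cycles within b |: C are in both cases the empty set and C, and each
   further spoke closes a cycle with b and its arc. *)
have evenZ D : even_set G D = Z D && (D \subset F).
  have [DF|nDF] := boolP (D \subset F); last first.
    by rewrite andbF /even_set /= eG (negPf nDF).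
  rewrite andbT; apply: (@cycle_space_agree _ _ _ (b |: C) F
    (fun e => symdiff (symdiff [set b] [set e]) (X e))) => //; last 2 first.
  - move=> B BbC; rewrite (even_rim_spoke up szp spG bS) rimC //.
    apply/orP/idP => [[] /eqP -> //|ZB]; first by case: spaceZ.
    have [_ _ onlyC] := min_cycleP _ _ minC.
    have [->|nB] := eqVneq B set0; [by left | right; apply/eqP/onlyC => //].
    exact: flatC ZB BbC.
  - exact: subset_trans DF (subsetUl _ _).
  - exact: even_cycle_space.
  move=> e; rewrite in_setD in_setU1 negb_or => /andP[/andP[eb eC] eF].
  have eS : e \in S by rewrite in_setD eC.
  have /and3P[XC _ Ze] := arcX e eS; split=> //.
  - apply: (even_spoke_path up szp spG (a := a) (l := l) (j := #|X e|)) => //.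
      by rewrite /h Xb cards0.
    by rewrite leX.
    exact: takel.
  - rewrite !in_symdiff !in_set1 eqxx (negPf eb) /=.
    by rewrite (contraNF (subsetP XC e)).
  apply/subsetP => x; rewrite !in_symdiff !in_set1 !in_setU1.
  have [//|xb] := eqVneq x b; first by rewrite orbT.
  by have [//|_ /= /(subsetP XC) ->] := eqVneq x e; rewrite ?orbT.
have repF : binary_rep (restrict M F) (even_set G).
  exact: restrict_binary_rep repZ (even_cycle_space G) evenZ.
have loopG := spoked_cycle_loopless up szp spG.
have cycF : is_cycle_matroid (restrict M F) G.
  split=> [|D]; first by rewrite eG; apply/setIidPr.
  by rewrite (circuit_min_cycle _ repF); apply: min_even_graph_cycle.
exists F; split; first exact: closure_flat.
exists (option E), G, C, S; split=> //.
  by rewrite -rimC; apply: spoked_cycle_enlarged up S2 _ injh spG => s sS; rewrite Sp ?hp.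
split=> //; split=> //; apply/(min_even_graph_cycle loopG).
have [_ nT minT] := min_cycleP _ _ min_tri.
apply/min_cycleP; rewrite evenZ Ztri; split=> //.
  by rewrite !subUset !sub1set (subsetP CF) ?bF.
by move=> D; rewrite evenZ => /andP[ZD _]; apply: minT.
Qed.
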